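(* Let $\delta=\delta(T)$ be a hermitian polynomial in $T$ (i.e. a polynomial in $T$ with real coefficients) which is invertible in $Z_{\mathrm{loc}}$, and define $\alpha\in Z_{\mathrm{loc}}$ via the relation $\partial_4\delta=2\alpha\delta$. If $$\phi_0(\alpha)\big|_{\psi=\pi/2}=\phi_0(\alpha)\big|_{\psi=-\pi/2}=0$$ (values at $\psi=\pm\pi/2$ being understood by continuous extension), then $$\chi(S^4_\theta):=\frac{1}{32\pi^2}\,\tau_{\delta,\mathrm{loc}}\big(R^{abcd}R_{abcd}-4\,\mathrm{Ric}_{ab}\mathrm{Ric}^{ab}+S^2\big)=2,$$ where repeated indices are summed over $\{1,2,3,4\}$.
   Context: Algebra. Let $\theta\in[0,1)$ and $q=e^{i2\pi\theta}$. $S^4_\theta$ is the unital $\ast$-algebra over $\mathbb{C}$ generated by $Z,W,T$ with relations $WZ=qZW$, $W^*Z=\bar q ZW^*$, $ZZ^*+WW^*+T^2=1$, $T^*=T$, $[T,Z]=[T,W]=[W,W^*]=[Z,Z^*]=0$. The elements $|Z|^2:=ZZ^*$, $|W|^2:=WW^*$ and $T$ are central. Put $X^1=\frac12(Z+Z^* )$, $X^2=\frac1{2i}(Z-Z^* )$, $X^3=\frac12(W+W^* )$, $X^4=\frac1{2i}(W-W^* )$, $X^5=T$. $S^4_{\theta,\mathrm{loc}}$ is the localization of $S^4_\theta$ at the multiplicative set generated by the central elements $1,|Z|^2,|W|^2,1-T^2,1+T^2$. $Z_{\mathrm{loc}}\subseteq S^4_{\theta,\mathrm{loc}}$ is the commutative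 subalgebra generated by $1,|Z|^2,|Z|^{-2},|W|^2,|W|^{-2},T,(1-T^2)^{-1},(1+T^2)^{-1}$. Derivations. A derivation $d$ is hermitian if $d(a^* )=d(a)^*$. Let $\tilde\partial_1,\dots,\tilde\partial_4$ be the hermitian derivations with $\tilde\partial_1Z=iZ,\ \tilde\partial_1W=0,\ \tilde\partial_1T=0$; $\tilde\partial_2Z=0,\ \tilde\partial_2W=iW,\ \tilde\partial_2T=0$; $\tilde\partial_3Z=Z|W|^2,\ \tilde\partial_3W=-W|Z|^2,\ \tilde\partial_3T=0$; $\tilde\partial_4Z=ZT,\ \tilde\partial_4W=WT,\ \tilde\partial_4T=T^2-1$ (extended to $S^4_{\theta,\mathrm{loc}}$). For $n\ge0$ set $\partial^{(n)}_1=T^n(1-T^2)\tilde\partial_1$, $\partial^{(n)}_2=T^n(1-T^2)\tilde\partial_2$, $\partial^{(n)}_3=T^n\tilde\partial_3$, $\partial_i=\partial_i^{(0)}$ ($i=1,2,3$), $\partial_4=\tilde\partial_4$. Let $\mathfrak g$ be the real Lie algebra spanned by all $\partial^{(n)}_1,\partial^{(n)}_2,\partial^{(n)}_3,\partial_4$. Module and metric. $M$ is the right submodule of $(S^4_{\theta,\mathrm{loc}})^5$ generated by (and free on) $E_1=(-X^2(1-T^2),X^1(1-T^2),0,0,0)$, $E_2=(0,0,-X^4(1-T^2),X^3(1-T^2),0)$, $E_3=(X^1|W|^2,X^2|W|^2,-X^3|Z|^2,-X^4|Z|^2,0)$, $E_4=(X^1T,X^2T,X^3T,X^4T,T^2-1)$.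 The metric is $h^\delta(U,V)=\sum_{a,b=1}^4(U^a)^*h^\delta_{ab}V^b$ for $U=\sum_aE_aU^a$, $V=\sum_bE_bV^b$, where $(h^\delta_{ab})=\delta\cdot\mathrm{diag}\big(|Z|^2(1-T^2)^2,\ |W|^2(1-T^2)^2,\ |Z|^2|W|^2(1-T^2),\ 1-T^2\big)$; its inverse matrix is denoted $((h^\delta)^{ab})$. Connection. An affine connection $\nabla:\mathfrak g\times M\to M$ is additive in $M$, $\mathbb{R}$-linear in $\mathfrak g$, and satisfies $\nabla_d(Ua)=(\nabla_dU)a+U\,d(a)$. Let $\varphi:\mathfrak g\to M$ be the $\mathbb R$-linear map with $\varphi(\partial_i^{(n)})=E_iT^n$ ($i=1,2,3$), $\varphi(\partial_4)=E_4$. $\nabla$ is the unique connection that is metric ($d(h^\delta(U,V))=h^\delta(\nabla_dU,V)+h^\delta(U,\nabla_dV)$), torsion-free ($\nabla_{d_1}\varphi(d_2)-\nabla_{d_2}\varphi(d_1)-\varphi([d_1,d_2])=0$) and real ($h^\delta(\nabla_dE,E')$ is hermitian for all $E,E'\in\varphi(\mathfrak g)$). Explicitly, with $\nabla_a=\nabla_{\partial_a}$ (note $\partial_i\delta=0$ for $i=1,2,3$): $\nabla_1E_1=-E_3(1-T^2)-E_4(\alpha+T)|Z|^2(1-T^2)$, $\nabla_2E_2=E_3(1-T^2)-E_4(\alpha+T)|W|^2(1-T^2)$, $\nabla_3E_3=E_3(|W|^2-|Z|^2)-E_4(\alpha+T)|Z|^2|W|^2$, $\nabla_4E_4=E_4(\alpha+T)$,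 $\nabla_1E_2=\nabla_2E_1=0$, $\nabla_1E_3=\nabla_3E_1=E_1|W|^2$, $\nabla_2E_3=\nabla_3E_2=-E_2|Z|^2$, $\nabla_iE_4=E_i(\alpha+T)$ and $\nabla_4E_i=E_i(\alpha+3T)$ for $i=1,2,3$, and $\nabla_{\partial^{(n)}_i}E_a=(\nabla_iE_a)T^n$. Curvature. $R(d_1,d_2)U=\nabla_{d_1}\nabla_{d_2}U-\nabla_{d_2}\nabla_{d_1}U-\nabla_{[d_1,d_2]}U$ and $R_{abpq}=h^\delta(E_a,R(\partial_p,\partial_q)E_b)$; all these components, and the entries of the metric and its inverse, lie in $Z_{\mathrm{loc}}$. With summation over repeated indices, $R^{abcd}=(h^\delta)^{ap}(h^\delta)^{bq}(h^\delta)^{cr}(h^\delta)^{ds}R_{pqrs}$, $\mathrm{Ric}_{ab}=(h^\delta)^{pq}R_{apbq}$, $\mathrm{Ric}^{ab}=(h^\delta)^{ap}(h^\delta)^{bq}\mathrm{Ric}_{pq}$, $S=(h^\delta)^{ab}\mathrm{Ric}_{ab}$. Trace. $\phi_0$ is the homomorphism of commutative $\ast$-algebras from $Z_{\mathrm{loc}}$ to the smooth functions of $(\xi_1,\xi_2,\varphi,\psi)$, $0<\xi_1,\xi_2<2\pi$, $0<\varphi<\pi/2$, $-\pi/2<\psi<\pi/2$, determined by $\phi_0(1)=1$, $\phi_0(|Z|^2)=\cos^2\varphi\cos^2\psi$, $\phi_0(|W|^2)=\sin^2\varphi\cos^2\psi$, $\phi_0(T)=\sin\psi$ (inverses being mapped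 to inverses). For $a\in Z_{\mathrm{loc}}$ for which the integral converges, $$\tau_{\delta,\mathrm{loc}}(a)=\int_0^{2\pi}d\xi_1\int_0^{2\pi}d\xi_2\int_{-\pi/2}^{\pi/2}d\psi\int_0^{\pi/2}d\varphi\;\phi_0(a)\,\phi_0(\delta^2)\cos^3\psi\,\sin\varphi\cos\varphi .$$ *)

(* Defs.v *)
From HB Require Import structures.
From mathcomp Require Import all_boot all_order all_algebra.
From mathcomp Require Import all_classical all_reals all_analysis.
From mathcomp Require Import complex.

Set Implicit Arguments.
Unset Strict Implicit.
Unset Printing Implicit Defensive.

Import Order.TTheory GRing.Theory Num.Theory.
Import numFieldNormedType.Exports.
Local Open Scope classical_set_scope.
Local Open Scope ring_scope.
Local Open Scope complex_scope.
Local Open Scope quotient_scope.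

(* Unital *-algebras over R[i] given by generators and relations: formal      *)
(* expressions modulo the least congruence that contains the relations and    *)
(* the axioms of unital *-algebras.                                           *)
Section StarPresentation.
Variables (R : rcfType) (G : Type).

Inductive sterm : Type :=
  | TGen of G
  | TZero
  | TOne
  | TAdd of sterm & sterm
  | TOpp of sterm
  | TMul of sterm & sterm
  | TScale of R[i] & sterm
  | TStar of sterm.

HB.instance Definition _ := gen_eqMixin sterm.
HB.instance Definition _ := gen_choiceMixin sterm.

Variable rel : sterm -> sterm -> Prop.

Inductive scong : sterm -> sterm -> Prop :=
  | sc_rel x y : rel x y -> scong x y
  | sc_refl x : scong x x
  | sc_sym x y : scong x y -> scong y x
  | sc_trans x y z : scong x y -> scong y z -> scong x z
  | sc_add x x' y y' :
      scong x x' -> scong y y' -> scong (TAdd x y) (TAdd x' y')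
  | sc_opp x x' : scong x x' -> scong (TOpp x) (TOpp x')
  | sc_mul x x' y y' :
      scong x x' -> scong y y' -> scong (TMul x y) (TMul x' y')
  | sc_scale c x x' : scong x x' -> scong (TScale c x) (TScale c x')
  | sc_star x x' : scong x x' -> scong (TStar x) (TStar x')
  | sc_addA x y z : scong (TAdd x (TAdd y z)) (TAdd (TAdd x y) z)
  | sc_addC x y : scong (TAdd x y) (TAdd y x)
  | sc_add0 x : scong (TAdd TZero x) x
  | sc_addN x : scong (TAdd (TOpp x) x) TZero
  | sc_mulA x y z : scong (TMul x (TMul y z)) (TMul (TMul x y) z)
  | sc_mul1l x : scong (TMul TOne x) x
  | sc_mul1r x : scong (TMul x TOne) x
  | sc_mulDl x y z : scong (TMul (TAdd x y) z) (TAdd (TMul x z) (TMul y z))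
  | sc_mulDr x y z : scong (TMul x (TAdd y z)) (TAdd (TMul x y) (TMul x z))
  | sc_scaleA a b x : scong (TScale a (TScale b x)) (TScale (a * b) x)
  | sc_scale1 x : scong (TScale 1 x) x
  | sc_scaleDr a x y :
      scong (TScale a (TAdd x y)) (TAdd (TScale a x) (TScale a y))
  | sc_scaleDl a b x :
      scong (TScale (a + b) x) (TAdd (TScale a x) (TScale b x))
  | sc_scaleAl a x y : scong (TScale a (TMul x y)) (TMul (TScale a x) y)
  | sc_scaleAr a x y : scong (TScale a (TMul x y)) (TMul x (TScale a y))
  | sc_starK x : scong (TStar (TStar x)) x
  | sc_starD x y : scong (TStar (TAdd x y)) (TAdd (TStar x) (TStar y))
  | sc_starM x y : scong (TStar (TMul x y)) (TMul (TStar y) (TStar x))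
  | sc_starZ a x : scong (TStar (TScale a x)) (TScale a^* (TStar x)).

Definition scongb (x y : sterm) : bool := `[< scong x y >].

Lemma scongb_equiv : equiv_class_of scongb.
Proof.
split.
- by move=> x; apply/asboolP; exact: sc_refl.
- by move=> x y; apply/asboolP/asboolP; exact: sc_sym.
- by move=> y x z /asboolP xy /asboolP yz; apply/asboolP; exact: sc_trans yz.
Qed.

Canonical scongb_equivRel := EquivRelPack scongb_equiv.

Definition starpres : Type := {eq_quot scongb_equivRel}.
HB.instance Definition _ := Choice.on starpres.

Definition spi (x : sterm) : starpres := \pi_{eq_quot scongb_equivRel} x.
Definition srepr (a : starpres) : sterm := repr (a : {eq_quot scongb_equivRel}).

Lemma sreprK : cancel srepr spi. Proof. by move=> a; exact: reprK. Qed.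

Lemma spiP x y : spi x = spi y <-> scong x y.
Proof. by split=> [/eqmodP/asboolP | xy]; [|exact/eqmodP/asboolP]. Qed.

Lemma spi_ind (P : starpres -> Prop) : (forall x, P (spi x)) -> forall a, P a.
Proof. by move=> HP a; rewrite -(sreprK a). Qed.

Lemma srepr_spi x : scong (srepr (spi x)) x.
Proof. by apply/spiP; rewrite sreprK. Qed.

Definition sadd (a b : starpres) := spi (TAdd (srepr a) (srepr b)).
Definition sopp (a : starpres) := spi (TOpp (srepr a)).
Definition smul (a b : starpres) := spi (TMul (srepr a) (srepr b)).
Definition sscale (c : R[i]) (a : starpres) := spi (TScale c (srepr a)).
Definition star (a : starpres) := spi (TStar (srepr a)).

Lemma spiD x y : sadd (spi x) (spi y) = spi (TAdd x y).
Proof. by apply/spiP; apply: sc_add; exact: srepr_spi. Qed.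
Lemma spiN x : sopp (spi x) = spi (TOpp x).
Proof. by apply/spiP; apply: sc_opp; exact: srepr_spi. Qed.
Lemma spiM x y : smul (spi x) (spi y) = spi (TMul x y).
Proof. by apply/spiP; apply: sc_mul; exact: srepr_spi. Qed.
Lemma spiZ c x : sscale c (spi x) = spi (TScale c x).
Proof. by apply/spiP; apply: sc_scale; exact: srepr_spi. Qed.
Lemma spi_star x : star (spi x) = spi (TStar x).
Proof. by apply/spiP; apply: sc_star; exact: srepr_spi. Qed.

Let spiE := (spiD, spiN, spiM, spiZ, spi_star).

Fact saddA : associative sadd.
Proof.
elim/spi_ind=> x; elim/spi_ind=> y; elim/spi_ind=> z.
by rewrite !spiE; apply/spiP; constructor.
Qed.
Fact saddC : commutative sadd.
Proof.
by elim/spi_ind=> x; elim/spi_ind=> y; rewrite !spiE; apply/spiP; exact: sc_addC.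
Qed.
Fact sadd0 : left_id (spi TZero) sadd.
Proof. by elim/spi_ind=> x; rewrite !spiE; apply/spiP; exact: sc_add0. Qed.
Fact saddN : left_inverse (spi TZero) sopp sadd.
Proof. by elim/spi_ind=> x; rewrite !spiE; apply/spiP; exact: sc_addN. Qed.

HB.instance Definition _ := GRing.isZmodule.Build starpres
  saddA saddC sadd0 saddN.

Fact smulA : associative smul.
Proof.
elim/spi_ind=> x; elim/spi_ind=> y; elim/spi_ind=> z.
by rewrite !spiE; apply/spiP; exact: sc_mulA.
Qed.
Fact smul1l : left_id (spi TOne) smul.
Proof. by elim/spi_ind=> x; rewrite !spiE; apply/spiP; exact: sc_mul1l. Qed.
Fact smul1r : right_id (spi TOne) smul.
Proof. by elim/spi_ind=> x; rewrite !spiE; apply/spiP; exact: sc_mul1r. Qed.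
Fact smulDl : left_distributive smul +%R.
Proof.
elim/spi_ind=> x; elim/spi_ind=> y; elim/spi_ind=> z.
by rewrite /GRing.add /= !spiE; apply/spiP; exact: sc_mulDl.
Qed.
Fact smulDr : right_distributive smul +%R.
Proof.
elim/spi_ind=> x; elim/spi_ind=> y; elim/spi_ind=> z.
by rewrite /GRing.add /= !spiE; apply/spiP; exact: sc_mulDr.
Qed.

(* Only a pzRingType and an lmodType: MathComp's algType asks for 1 != 0,     *)
(* which depends on the relations.                                            *)
HB.instance Definition _ := GRing.Zmodule_isPzRing.Build starpres
  smulA smul1l smul1r smulDl smulDr.

Fact sscaleA a b v : sscale a (sscale b v) = sscale (a * b) v.
Proof. by elim/spi_ind: v => x; rewrite !spiE; apply/spiP; exact: sc_scaleA. Qed.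
Fact sscale1 : left_id 1 sscale.
Proof. by elim/spi_ind=> x; rewrite !spiE; apply/spiP; exact: sc_scale1. Qed.
Fact sscaleDr : right_distributive sscale +%R.
Proof.
move=> c; elim/spi_ind=> x; elim/spi_ind=> y.
by rewrite /GRing.add /= !spiE; apply/spiP; exact: sc_scaleDr.
Qed.
Fact sscaleDl v : {morph sscale^~ v : a b / a + b}.
Proof.
elim/spi_ind: v => x a b.
by rewrite {2}/GRing.add /= !spiE; apply/spiP; exact: sc_scaleDl.
Qed.

HB.instance Definition _ := GRing.Zmodule_isLmodule.Build R[i] starpres
  sscaleA sscale1 sscaleDr sscaleDl.

Lemma sscalerAl (c : R[i]) (a b : starpres) : c *: (a * b) = (c *: a) * b.
Proof.
elim/spi_ind: a => x; elim/spi_ind: b => y.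
by rewrite /GRing.scale /GRing.mul /= !spiE; apply/spiP; exact: sc_scaleAl.
Qed.
Lemma sscalerAr (c : R[i]) (a b : starpres) : c *: (a * b) = a * (c *: b).
Proof.
elim/spi_ind: a => x; elim/spi_ind: b => y.
by rewrite /GRing.scale /GRing.mul /= !spiE; apply/spiP; exact: sc_scaleAr.
Qed.

Lemma starK : involutive star.
Proof. by elim/spi_ind=> x; rewrite !spiE; apply/spiP; exact: sc_starK. Qed.
Lemma starD : {morph star : a b / a + b}.
Proof.
elim/spi_ind=> x; elim/spi_ind=> y.
by rewrite /GRing.add /= !spiE; apply/spiP; exact: sc_starD.
Qed.
Lemma starM (a b : starpres) : star (a * b) = star b * star a.
Proof.
elim/spi_ind: a => x; elim/spi_ind: b => y.
by rewrite /GRing.mul /= !spiE; apply/spiP; exact: sc_starM.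
Qed.
Lemma starZ (c : R[i]) (a : starpres) : star (c *: a) = c^* *: star a.
Proof.
elim/spi_ind: a => x.
by rewrite /GRing.scale /= !spiE; apply/spiP; exact: sc_starZ.
Qed.

Definition sgen (g : G) : starpres := spi (TGen g).

End StarPresentation.

Arguments TGen {R G}.
Arguments TZero {R G}.
Arguments TOne {R G}.

(* Localization at a set S: formal inverses of the elements of S are adjoined *)
(* to the algebra (by the universal property, this is the algebra of          *)
(* fractions when S is multiplicative and central).                           *)
Section Localization.
Variables (R : rcfType) (G : Type) (rel : sterm R G -> sterm R G -> Prop).
Notation A := (starpres rel).
Variable S : A -> Prop.

Definition locgen : Type := (A + {s : A | S s})%type.

Inductive locrel : sterm R locgen -> sterm R locgen -> Prop :=
  | lr_add a b :
      locrel (TGen (inl (a + b))) (TAdd (TGen (inl a)) (TGen (inl b)))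
  | lr_mul a b :
      locrel (TGen (inl (a * b))) (TMul (TGen (inl a)) (TGen (inl b)))
  | lr_one : locrel (TGen (inl 1)) TOne
  | lr_scale c a : locrel (TGen (inl (c *: a))) (TScale c (TGen (inl a)))
  | lr_star a : locrel (TGen (inl (star a))) (TStar (TGen (inl a)))
  | lr_invl s : locrel (TMul (TGen (inr s)) (TGen (inl (sval s)))) TOne
  | lr_invr s : locrel (TMul (TGen (inl (sval s))) (TGen (inr s))) TOne.

Definition localization : Type := starpres locrel.
HB.instance Definition _ := GRing.PzRing.on localization.
HB.instance Definition _ := GRing.Lmodule.on localization.

Definition toloc (a : A) : localization := sgen locrel (inl a).
Definition locinv (a : A) (Sa : S a) : localization :=
  sgen locrel (inr (exist _ a Sa)).

End Localization.

Section Sphere.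
Variables (R : realType) (theta : R).

Definition qpar : R[i] := cos (2 * pi * theta) +i* sin (2 * pi * theta).

Inductive S4gen : Type := gZ | gW | gT.

Inductive S4rel : sterm R S4gen -> sterm R S4gen -> Prop :=
  | S4_WZ : S4rel (TMul (TGen gW) (TGen gZ))
                  (TScale qpar (TMul (TGen gZ) (TGen gW)))
  | S4_WsZ : S4rel (TMul (TStar (TGen gW)) (TGen gZ))
                   (TScale qpar^* (TMul (TGen gZ) (TStar (TGen gW))))
  | S4_sphere : S4rel (TAdd (TAdd (TMul (TGen gZ) (TStar (TGen gZ)))
                                  (TMul (TGen gW) (TStar (TGen gW))))
                            (TMul (TGen gT) (TGen gT)))
                      TOne
  | S4_Ts : S4rel (TStar (TGen gT)) (TGen gT)
  | S4_TZ : S4rel (TMul (TGen gT) (TGen gZ)) (TMul (TGen gZ) (TGen gT))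
  | S4_TW : S4rel (TMul (TGen gT) (TGen gW)) (TMul (TGen gW) (TGen gT))
  | S4_WWs : S4rel (TMul (TGen gW) (TStar (TGen gW)))
                   (TMul (TStar (TGen gW)) (TGen gW))
  | S4_ZZs : S4rel (TMul (TGen gZ) (TStar (TGen gZ)))
                   (TMul (TStar (TGen gZ)) (TGen gZ)).

Definition S4 : Type := starpres S4rel.
HB.instance Definition _ := GRing.PzRing.on S4.
HB.instance Definition _ := GRing.Lmodule.on S4.

Definition Z0 : S4 := sgen S4rel gZ.
Definition W0 : S4 := sgen S4rel gW.
Definition T0 : S4 := sgen S4rel gT.

Inductive S4mult : S4 -> Prop :=
  | S4m_one : S4mult 1
  | S4m_Z : S4mult (Z0 * star Z0)
  | S4m_W : S4mult (W0 * star W0)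
  | S4m_mT : S4mult (1 - T0 ^+ 2)
  | S4m_pT : S4mult (1 + T0 ^+ 2)
  | S4m_mul s t : S4mult s -> S4mult t -> S4mult (s * t).

Definition S4loc : Type := localization S4mult.
HB.instance Definition _ := GRing.PzRing.on S4loc.
HB.instance Definition _ := GRing.Lmodule.on S4loc.

Definition Z : S4loc := toloc S4mult Z0.
Definition W : S4loc := toloc S4mult W0.
Definition T : S4loc := toloc S4mult T0.

Notation "a ^s" := (star a : S4loc) (at level 1, format "a ^s").

Definition Z2 : S4loc := Z * Z^s.
Definition W2 : S4loc := W * W^s.
Definition Z2inv : S4loc := locinv S4m_Z.
Definition W2inv : S4loc := locinv S4m_W.
Definition mT2inv : S4loc := locinv S4m_mT.
Definition pT2inv : S4loc := locinv S4m_pT.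

Definition X1 : S4loc := (2^-1 : R[i]) *: (Z + Z^s).
Definition X2 : S4loc := ((2 * 'i)^-1 : R[i]) *: (Z - Z^s).
Definition X3 : S4loc := (2^-1 : R[i]) *: (W + W^s).
Definition X4 : S4loc := ((2 * 'i)^-1 : R[i]) *: (W - W^s).

Inductive Zloc : S4loc -> Prop :=
  | Zl_one : Zloc 1
  | Zl_Z2 : Zloc Z2
  | Zl_Z2inv : Zloc Z2inv
  | Zl_W2 : Zloc W2
  | Zl_W2inv : Zloc W2inv
  | Zl_T : Zloc T
  | Zl_mT2inv : Zloc mT2inv
  | Zl_pT2inv : Zloc pT2inv
  | Zl_add a b : Zloc a -> Zloc b -> Zloc (a + b)
  | Zl_scale (c : R[i]) a : Zloc a -> Zloc (c *: a)
  | Zl_mul a b : Zloc a -> Zloc b -> Zloc (a * b).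

Definition is_derivation (d : S4loc -> S4loc) : Prop :=
  [/\ forall a b, d (a + b) = d a + d b,
      forall (c : R[i]) a, d (c *: a) = c *: d a
    & forall a b, d (a * b) = d a * b + a * d b].

Definition hermitian_derivation (d : S4loc -> S4loc) : Prop :=
  is_derivation d /\ forall a, d a^s = (d a)^s.

(* dt1, dt2, dt3, dt4 are the derivations written with a tilde. *)
Record is_dtilde (dt1 dt2 dt3 dt4 : S4loc -> S4loc) : Prop := IsDtilde {
  dt1_der : hermitian_derivation dt1;
  dt2_der : hermitian_derivation dt2;
  dt3_der : hermitian_derivation dt3;
  dt4_der : hermitian_derivation dt4;
  dt1E : [/\ dt1 Z = ('i : R[i]) *: Z, dt1 W = 0 & dt1 T = 0];
  dt2E : [/\ dt2 Z = 0, dt2 W = ('i : R[i]) *: W & dt2 T = 0];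
  dt3E : [/\ dt3 Z = Z * W2, dt3 W = - (W * Z2) & dt3 T = 0];
  dt4E : [/\ dt4 Z = Z * T, dt4 W = W * T & dt4 T = T ^+ 2 - 1] }.

(* M is a right module: vmul U a is U a. *)
Definition vmul (U : 'cV[S4loc]_5) (a : S4loc) : 'cV[S4loc]_5 :=
  \col_i (U i 0 * a).

Definition vscale (r : R) (U : 'cV[S4loc]_5) : 'cV[S4loc]_5 :=
  \col_i (r%:C *: U i 0).

Definition vec5 (x1 x2 x3 x4 x5 : S4loc) : 'cV[S4loc]_5 :=
  \col_i tnth [tuple x1; x2; x3; x4; x5] i.

Definition E1 := vec5 (- (X2 * (1 - T ^+ 2))) (X1 * (1 - T ^+ 2)) 0 0 0.
Definition E2 := vec5 0 0 (- (X4 * (1 - T ^+ 2))) (X3 * (1 - T ^+ 2)) 0.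
Definition E3 := vec5 (X1 * W2) (X2 * W2) (- (X3 * Z2)) (- (X4 * Z2)) 0.
Definition E4 := vec5 (X1 * T) (X2 * T) (X3 * T) (X4 * T) (T ^+ 2 - 1).
Definition E (a : 'I_4) : 'cV[S4loc]_5 := tnth [tuple E1; E2; E3; E4] a.

Definition lincomb (c : 'cV[S4loc]_4) : 'cV[S4loc]_5 :=
  \sum_a vmul (E a) (c a 0).

Definition inM (U : 'cV[S4loc]_5) : Prop := exists c, U = lincomb c.

(* The components U^a of U in M (unique, as M is free on the E_a). *)
Definition coord (U : 'cV[S4loc]_5) : 'cV[S4loc]_4 :=
  xget 0 [set c | U = lincomb c].

Definition polyT (p : {poly R}) : S4loc :=
  \sum_(k < size p) (p`_k)%:C *: T ^+ k.

Definition hmx (delta : S4loc) : 'M[S4loc]_4 :=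
  \matrix_(a, b) if a == b then
    delta * tnth [tuple Z2 * (1 - T ^+ 2) ^+ 2; W2 * (1 - T ^+ 2) ^+ 2;
                        Z2 * W2 * (1 - T ^+ 2); 1 - T ^+ 2] a
  else 0.

Definition hform (delta : S4loc) (U V : 'cV[S4loc]_5) : S4loc :=
  \sum_a \sum_b (coord U a 0)^s * hmx delta a b * coord V b 0.

Section LieAlgebra.
Variables dt1 dt2 dt3 dt4 : S4loc -> S4loc.

Definition d1 (n : nat) (x : S4loc) : S4loc :=
  T ^+ n * (1 - T ^+ 2) * dt1 x.
Definition d2 (n : nat) (x : S4loc) : S4loc :=
  T ^+ n * (1 - T ^+ 2) * dt2 x.
Definition d3 (n : nat) (x : S4loc) : S4loc := T ^+ n * dt3 x.

Definition pd (a : 'I_4) : S4loc -> S4loc :=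
  tnth [tuple d1 0; d2 0; d3 0; dt4] a.

Inductive inG : (S4loc -> S4loc) -> Prop :=
  | inG_d1 n : inG (d1 n)
  | inG_d2 n : inG (d2 n)
  | inG_d3 n : inG (d3 n)
  | inG_d4 : inG dt4
  | inG_add d d' : inG d -> inG d' -> inG (fun x => d x + d' x)
  | inG_scale (r : R) d : inG d -> inG (fun x => r%:C *: d x).

Definition bracket (d d' : S4loc -> S4loc) : S4loc -> S4loc :=
  fun x => d (d' x) - d' (d x).

Record is_varphi (vphi : (S4loc -> S4loc) -> 'cV[S4loc]_5) : Prop := IsVarphi {
  vphi_add d d' : inG d -> inG d' ->
    vphi (fun x => d x + d' x) = vphi d + vphi d';
  vphi_scale (r : R) d : inG d ->
    vphi (fun x => r%:C *: d x) = vscale r (vphi d);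
  vphi_d1 n : vphi (d1 n) = vmul E1 (T ^+ n);
  vphi_d2 n : vphi (d2 n) = vmul E2 (T ^+ n);
  vphi_d3 n : vphi (d3 n) = vmul E3 (T ^+ n);
  vphi_d4 : vphi dt4 = E4 }.

(* nabla is only constrained on inG and inM, i.e. it stands for a map         *)
(* g x M -> M.                                                                *)
Record is_connection
    (nabla : (S4loc -> S4loc) -> 'cV[S4loc]_5 -> 'cV[S4loc]_5) : Prop :=
  IsConnection {
  nabla_in d U : inG d -> inM U -> inM (nabla d U);
  nabla_add d U V : inG d -> inM U -> inM V ->
    nabla d (U + V) = nabla d U + nabla d V;
  nabla_addl d d' U : inG d -> inG d' -> inM U ->
    nabla (fun x => d x + d' x) U = nabla d U + nabla d' U;
  nabla_scalel (r : R) d U : inG d -> inM U ->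
    nabla (fun x => r%:C *: d x) U = vscale r (nabla d U);
  nabla_leibniz d U a : inG d -> inM U ->
    nabla d (vmul U a) = vmul (nabla d U) a + vmul U (d a) }.

Definition metric_connection (delta : S4loc)
    (nabla : (S4loc -> S4loc) -> 'cV[S4loc]_5 -> 'cV[S4loc]_5) : Prop :=
  forall d U V, inG d -> inM U -> inM V ->
    d (hform delta U V) = hform delta (nabla d U) V + hform delta U (nabla d V).

Definition torsion_free (vphi : (S4loc -> S4loc) -> 'cV[S4loc]_5)
    (nabla : (S4loc -> S4loc) -> 'cV[S4loc]_5 -> 'cV[S4loc]_5) : Prop :=
  forall d d', inG d -> inG d' ->
    nabla d (vphi d') - nabla d' (vphi d) - vphi (bracket d d') = 0.

Definition real_connection (delta : S4loc)
    (vphi : (S4loc -> S4loc) -> 'cV[S4loc]_5)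
    (nabla : (S4loc -> S4loc) -> 'cV[S4loc]_5 -> 'cV[S4loc]_5) : Prop :=
  forall d e e', inG d -> inG e -> inG e' ->
    (hform delta (nabla d (vphi e)) (vphi e'))^s
      = hform delta (nabla d (vphi e)) (vphi e').

Section Curvature.
Variables (nabla : (S4loc -> S4loc) -> 'cV[S4loc]_5 -> 'cV[S4loc]_5)
  (delta : S4loc) (hinv : 'M[S4loc]_4).

Definition curv (d d' : S4loc -> S4loc) (U : 'cV[S4loc]_5) : 'cV[S4loc]_5 :=
  nabla d (nabla d' U) - nabla d' (nabla d U) - nabla (bracket d d') U.

Definition Rlow (a b p q : 'I_4) : S4loc :=
  hform delta (E a) (curv (pd p) (pd q) (E b)).

Definition Rup (a b c d : 'I_4) : S4loc :=
  \sum_p \sum_q \sum_r \sum_s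
    hinv a p * hinv b q * hinv c r * hinv d s * Rlow p q r s.

Definition Riclow (a b : 'I_4) : S4loc :=
  \sum_p \sum_q hinv p q * Rlow a p b q.

Definition Ricup (a b : 'I_4) : S4loc :=
  \sum_p \sum_q hinv a p * hinv b q * Riclow p q.

Definition Scal : S4loc := \sum_a \sum_b hinv a b * Riclow a b.

Definition gauss_bonnet : S4loc :=
  (\sum_a \sum_b \sum_c \sum_d Rup a b c d * Rlow a b c d)
  - (\sum_a \sum_b Riclow a b * Ricup a b) *+ 4
  + Scal ^+ 2.

End Curvature.
End LieAlgebra.

Definition in_box (xi1 xi2 ph ps : R) : Prop :=
  [/\ 0 < xi1 < 2 * pi, 0 < xi2 < 2 * pi, 0 < ph < pi / 2
    & - (pi / 2) < ps < pi / 2].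

(* phi0 a xi1 xi2 ph ps is the value of phi_0(a) at (xi1, xi2, ph, ps).  Its  *)
(* smoothness is implied by the values on the generators of Zloc.             *)
Record is_phi0 (phi0 : S4loc -> R -> R -> R -> R -> R[i]) : Prop := IsPhi0 {
  phi0_add a b x1 x2 ph ps : Zloc a -> Zloc b -> in_box x1 x2 ph ps ->
    phi0 (a + b) x1 x2 ph ps = phi0 a x1 x2 ph ps + phi0 b x1 x2 ph ps;
  phi0_scale (c : R[i]) a x1 x2 ph ps : Zloc a -> in_box x1 x2 ph ps ->
    phi0 (c *: a) x1 x2 ph ps = c * phi0 a x1 x2 ph ps;
  phi0_mul a b x1 x2 ph ps : Zloc a -> Zloc b -> in_box x1 x2 ph ps ->
    phi0 (a * b) x1 x2 ph ps = phi0 a x1 x2 ph ps * phi0 b x1 x2 ph ps;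
  phi0_star a x1 x2 ph ps : Zloc a -> in_box x1 x2 ph ps ->
    phi0 a^s x1 x2 ph ps = (phi0 a x1 x2 ph ps)^*;
  phi0_one x1 x2 ph ps : in_box x1 x2 ph ps -> phi0 1 x1 x2 ph ps = 1;
  phi0_Z2 x1 x2 ph ps : in_box x1 x2 ph ps ->
    phi0 Z2 x1 x2 ph ps = (cos ph ^+ 2 * cos ps ^+ 2)%:C;
  phi0_W2 x1 x2 ph ps : in_box x1 x2 ph ps ->
    phi0 W2 x1 x2 ph ps = (sin ph ^+ 2 * cos ps ^+ 2)%:C;
  phi0_T x1 x2 ph ps : in_box x1 x2 ph ps ->
    phi0 T x1 x2 ph ps = (sin ps)%:C }.

(* F vanishes, by continuous extension, at ps = pi/2 and at ps = -pi/2. *)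
Definition vanishes_at_poles (F : R -> R -> R -> R -> R[i]) : Prop :=
  forall x1 x2 ph : R, 0 < x1 < 2 * pi -> 0 < x2 < 2 * pi -> 0 < ph < pi / 2 ->
  [/\ complex.Re (F x1 x2 ph ps) @[ps --> (pi / 2)^'-] --> (0 : R),
      complex.Im (F x1 x2 ph ps) @[ps --> (pi / 2)^'-] --> (0 : R),
      complex.Re (F x1 x2 ph ps) @[ps --> (- (pi / 2))^'+] --> (0 : R)
    & complex.Im (F x1 x2 ph ps) @[ps --> (- (pi / 2))^'+] --> (0 : R)].

Definition cint (D : set R) (f : R -> R[i]) : R[i] :=
  (\int[lebesgue_measure]_(x in D) complex.Re (f x))
  +i* (\int[lebesgue_measure]_(x in D) complex.Im (f x)).

Section Trace.
Variables (phi0 : S4loc -> R -> R -> R -> R -> R[i]) (delta a : S4loc).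

Definition tau_integrand (x1 x2 ps ph : R) : R[i] :=
  phi0 a x1 x2 ph ps * phi0 (delta ^+ 2) x1 x2 ph ps
  * (cos ps ^+ 3 * sin ph * cos ph)%:C.

Definition tau : R[i] :=
  cint `]0, 2 * pi[ (fun x1 => cint `]0, 2 * pi[ (fun x2 =>
    cint `]- (pi / 2), pi / 2[ (fun ps => cint `]0, pi / 2[ (fun ph =>
      tau_integrand x1 x2 ps ph)))).

Let mu := @lebesgue_measure R.
Let box : set (R * R * R * R) :=
  `]0, 2 * pi[ `*` `]0, 2 * pi[ `*` `]- (pi / 2), pi / 2[ `*` `]0, pi / 2[.

Definition tau_defined : Prop :=
  [/\ Zloc a,
      (mu \x mu \x mu \x mu)%E.-integrable box
        (fun x => (complex.Re (tau_integrand x.1.1.1 x.1.1.2 x.1.2 x.2))%:E)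
    & (mu \x mu \x mu \x mu)%E.-integrable box
        (fun x => (complex.Im (tau_integrand x.1.1.1 x.1.1.2 x.1.2 x.2))%:E)].

End Trace.

End Sphere.

(* Main.v *)
Require Import Defs.
From HB Require Import structures.
From mathcomp Require Import all_boot all_order all_algebra.
From mathcomp Require Import all_classical all_reals all_analysis.
From mathcomp Require Import complex measurable_realfun ring lra.

Set Implicit Arguments.
Unset Strict Implicit.
Unset Printing Implicit Defensive.

Import Order.TTheory GRing.Theory Num.Theory.
Import numFieldNormedType.Exports.
Local Open Scope ring_scope.
Local Open Scope complex_scope.

(** The proof is the classical Gauss-Bonnet computation for a metric on S^4
    that is conformal to the round one by a function of the height T.

    Noncommutativity does not enter the curvature. The algebra Z_loc is central
    (Zloc_central), the derivations of the Lie algebra preserve it, and the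
    metric, the Christoffel symbols and the curvature have their entries in it;
    it is therefore turned into a commutative ring, Zring, in which identities
    are proved by ring normalization. The full algebra matters at two points
    only: a bracket of derivations is identified through its values on Z, W and T
    (der_ext, bracket_pd), and M is free because the real and imaginary parts of
    the normal elements Z and W act as rotations (lincomb_inj).

    A real, metric and torsion-free connection satisfies the Koszul formula
    (koszul), which determines the Christoffel symbols (christoffel). They are
    linear in the first argument over the powers of T, as the derivatives of the
    scaling factor cancel in the Koszul expression (koszul_tensorial); this gives
    the connection along the brackets, which are multiples of T times a frame
    field. Put f = alpha + T. The curvature operator (curvE) is diagonal on planes
    of frame fields, with the curvature
        L = (1 - f^2) / (delta (1 - T^2))
    on the planes tangent to the slices of constant T and
        K = - partial_4 f / (delta (1 - T^2))
    on the planes containing E_4. The Gauss-Bonnet polynomial of such a tensor is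
    24 K L (gb_sum).

    Under phi_0, with T = sin psi and delta = p(T), the element f becomes
        F(x) = x + (x^2 - 1) p'(x) / (2 p(x))   at x = sin psi,
    and partial_4 becomes (x^2 - 1) d/dx. The factor delta^2 of the trace cancels
    the conformal factor, and the integrand is
        24 (1 - F^2) F' (sin psi) cos psi sin phi cos phi,
    which is exact in psi: a primitive of its factor in psi is F - F^3 / 3 at
    sin psi (is_derive_gb_primitive). If p does not vanish at 1 and -1, then
    F(1) = 1 and F(-1) = -1, and the four integrations give
    24 (4/3) (1/2) (2 pi)^2 = 64 pi^2. A zero of order k of p at 1 or -1 would give
    alpha the limit k or -k there (pole_nonroot), which the hypothesis on the
    poles excludes. *)

(** * Algebras given by generators and relations, and their localizations *)

Section Generation.
Variables (R : rcfType) (G : Type) (rel : sterm R G -> sterm R G -> Prop).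

(** Since 0 and the opposite are scalar multiples, closure under sums, scalings,
    products and the involution is enough. *)
Lemma starpres_gen_ind (P : starpres rel -> Prop) :
  P 1 -> (forall a b, P a -> P b -> P (a + b)) ->
  (forall c a, P a -> P (c *: a)) -> (forall a b, P a -> P b -> P (a * b)) ->
  (forall a, P a -> P (star a)) -> (forall g, P (sgen rel g)) ->
  forall a, P a.
Proof.
move=> P1 PD PZ PM Ps Pg.
elim/spi_ind; elim=> [g|||x IHx y IHy|x IHx|x IHx y IHy|c x IHx|x IHx].
- exact: Pg.
- have -> : spi rel TZero = 0 *: (1 : starpres rel) by rewrite scale0r.
  exact: PZ.
- exact: P1.
- by rewrite -spiD; exact: PD.
- by rewrite -spiN -[sopp _]/(- spi rel x) -scaleN1r; exact: PZ.
- by rewrite -spiM; exact: PM.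
- by rewrite -spiZ; exact: PZ.
- by rewrite -spi_star; exact: Ps.
Qed.

Lemma star1 : star (1 : starpres rel) = 1.
Proof.
by have := starM (star (1 : starpres rel)) 1; rewrite starK mulr1 starK => /esym.
Qed.

Lemma star0 : star (0 : starpres rel) = 0.
Proof. by rewrite -[0](scale0r (1 : starpres rel)) starZ star1 rmorph0. Qed.

Lemma starB (a b : starpres rel) : star (a - b) = star a - star b.
Proof.
by rewrite starD -scaleN1r starZ rmorphN rmorph1 scaleN1r.
Qed.

Lemma starX (a : starpres rel) n : star (a ^+ n) = star a ^+ n.
Proof. by elim: n => [|n IH]; rewrite ?expr0 ?star1// exprS starM IH exprSr. Qed.

Lemma star_sum (I : Type) (r : seq I) (P : pred I) (F : I -> starpres rel) :
  star (\sum_(i <- r | P i) F i) = \sum_(i <- r | P i) star (F i).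
Proof. by apply: (big_morph _ (@starD _ _ rel) star0). Qed.

End Generation.

Section Localized.
Variables (R : rcfType) (G : Type) (rel : sterm R G -> sterm R G -> Prop).
Variable S : starpres rel -> Prop.
Notation loc := (localization S).
Notation toloc := (toloc S).

Lemma tolocD a b : toloc (a + b) = toloc a + toloc b.
Proof. by rewrite /Defs.toloc /sgen [RHS]spiD; apply/spiP/sc_rel; constructor. Qed.
Lemma tolocM a b : toloc (a * b) = toloc a * toloc b.
Proof. by rewrite /Defs.toloc /sgen [RHS]spiM; apply/spiP/sc_rel; constructor. Qed.
Lemma toloc1 : toloc 1 = 1.
Proof. by apply/spiP/sc_rel; constructor. Qed.
Lemma tolocZ c a : toloc (c *: a) = c *: toloc a.
Proof. by rewrite /Defs.toloc /sgen [RHS]spiZ; apply/spiP/sc_rel; constructor. Qed.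
Lemma toloc_star a : toloc (star a) = star (toloc a).
Proof. by rewrite /Defs.toloc /sgen [RHS]spi_star; apply/spiP/sc_rel; constructor. Qed.
Lemma locinv_l a (Sa : S a) : locinv Sa * toloc a = 1.
Proof.
rewrite /locinv /Defs.toloc /sgen [LHS]spiM; apply/spiP/sc_rel.
exact: (lr_invl (exist _ a Sa)).
Qed.
Lemma locinv_r a (Sa : S a) : toloc a * locinv Sa = 1.
Proof.
rewrite /locinv /Defs.toloc /sgen [LHS]spiM; apply/spiP/sc_rel.
exact: (lr_invr (exist _ a Sa)).
Qed.

(** A localization is generated by the images of the generators once inverses are
    allowed; the formal inverses need no case of their own. *)
Lemma loc_ind (P : loc -> Prop) :
  P 1 -> (forall a b, P a -> P b -> P (a + b)) ->
  (forall c a, P a -> P (c *: a)) -> (forall a b, P a -> P b -> P (a * b)) ->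
  (forall a, P a -> P (star a)) ->
  (forall a b, a * b = 1 -> b * a = 1 -> P a -> P b) ->
  (forall g, P (toloc (sgen rel g))) ->
  forall a, P a.
Proof.
move=> P1 PD PZ PM Ps PV Pg.
have Ptoloc a : P (toloc a).
  elim/starpres_gen_ind: a => //.
  - by rewrite toloc1.
  - by move=> a b Pa Pb; rewrite tolocD; exact: PD.
  - by move=> c a Pa; rewrite tolocZ; exact: PZ.
  - by move=> a b Pa Pb; rewrite tolocM; exact: PM.
  - by move=> a Pa; rewrite toloc_star; exact: Ps.
elim/starpres_gen_ind => // -[a|[a Sa]]; first exact: Ptoloc.
exact: PV (locinv_r Sa) (locinv_l Sa) (Ptoloc a).
Qed.

End Localized.

(** * Relations in the localized sphere and its central elements *)

Section Relations.
Variables (R : realType) (theta : R).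
Local Notation A := (S4loc theta).
Local Notation Z := (Z theta).
Local Notation W := (W theta).
Local Notation T := (T theta).
Local Notation Z2 := (Z2 theta).
Local Notation W2 := (W2 theta).
Local Notation q := (qpar theta).
Implicit Types (a b c : A).

Lemma S4loc_ind (P : A -> Prop) :
  P 1 -> (forall a b, P a -> P b -> P (a + b)) ->
  (forall (k : R[i]) a, P a -> P (k *: a)) -> (forall a b, P a -> P b -> P (a * b)) ->
  (forall a, P a -> P (star a)) ->
  (forall a b, a * b = 1 -> b * a = 1 -> P a -> P b) ->
  P Z -> P W -> P T -> forall a, P a.
Proof.
by move=> P1 PD PZ PM Ps PV Pz Pw Pt; apply: loc_ind => // -[].
Qed.

Lemma scal_mulAl (k : R[i]) a b : (k *: a) * b = k *: (a * b).
Proof. exact: esym (sscalerAl k a b). Qed.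
Lemma scal_mulAr (k : R[i]) a b : a * (k *: b) = k *: (a * b).
Proof. exact: esym (sscalerAr k a b). Qed.

Let rel_eq x y (xy : S4rel theta x y) : spi (S4rel theta) x = spi (S4rel theta) y.
Proof. exact/spiP/sc_rel. Qed.

Lemma WZ_comm : W * Z = q *: (Z * W).
Proof.
rewrite -[LHS]tolocM -[Z * W]tolocM -[RHS]tolocZ; congr toloc.
by have := rel_eq (S4_WZ theta); rewrite -spiZ -!spiM.
Qed.

Lemma WsZ_comm : star W * Z = q^* *: (Z * star W).
Proof.
rewrite -[star W]toloc_star -[LHS]tolocM -[Z * _]tolocM -[RHS]tolocZ; congr toloc.
by have := rel_eq (S4_WsZ theta); rewrite -spiZ -!spiM -spi_star.
Qed.

Lemma T_star : star T = T.
Proof.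
rewrite -[LHS]toloc_star; congr toloc.
by have := rel_eq (S4_Ts theta); rewrite -spi_star.
Qed.

Lemma TZ_comm : T * Z = Z * T.
Proof.
rewrite -[LHS]tolocM -[RHS]tolocM; congr toloc.
by have := rel_eq (S4_TZ theta); rewrite -!spiM.
Qed.

Lemma TW_comm : T * W = W * T.
Proof.
rewrite -[LHS]tolocM -[RHS]tolocM; congr toloc.
by have := rel_eq (S4_TW theta); rewrite -!spiM.
Qed.

Lemma Z_normal : Z * star Z = star Z * Z.
Proof.
rewrite -[star Z]toloc_star -[LHS]tolocM -[RHS]tolocM; congr toloc.
by have := rel_eq (S4_ZZs theta); rewrite -!spiM -spi_star.
Qed.

Lemma W_normal : W * star W = star W * W.
Proof.
rewrite -[star W]toloc_star -[LHS]tolocM -[RHS]tolocM; congr toloc.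
by have := rel_eq (S4_WWs theta); rewrite -!spiM -spi_star.
Qed.

Lemma sphere_eq : Z2 + W2 + T ^+ 2 = 1.
Proof.
rewrite /Defs.Z2 /Defs.W2 expr2 -[star Z]toloc_star -[star W]toloc_star.
rewrite -![toloc _ _ * toloc _ _]tolocM.
rewrite -[toloc _ _ + toloc _ _]tolocD -[LHS]tolocD -[RHS]toloc1; congr toloc.
by have := rel_eq (S4_sphere theta); rewrite -!(spiD, spiM) -!spi_star.
Qed.

Lemma W2E : W2 = 1 - T ^+ 2 - Z2.
Proof. by rewrite -sphere_eq addrK addrC addKr. Qed.

Lemma Z2_star : star Z2 = Z2. Proof. by rewrite starM starK. Qed.
Lemma W2_star : star W2 = W2. Proof. by rewrite starM starK. Qed.

Definition central c := forall a, c * a = a * c.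

(** The commutant of c is closed under the involution because c is hermitian,
    and under inverses because a commutant always is. *)
Lemma central_ind c : star c = c -> c * Z = Z * c -> c * W = W * c ->
  c * T = T * c -> central c.
Proof.
move=> cs cZ cW cT; elim/S4loc_ind => //.
- by rewrite mulr1 mul1r.
- by move=> a b ca cb; rewrite mulrDr mulrDl ca cb.
- by move=> k a ca; rewrite scal_mulAl scal_mulAr ca.
- by move=> a b ca cb; rewrite mulrA ca -mulrA cb mulrA.
- by move=> a ca; rewrite -cs -!starM ca.
- move=> a b ab ba ca.
  by rewrite -[b * c]mulr1 -ab mulrA -(mulrA b) ca (mulrA b) ba mul1r.
Qed.

Lemma central_star c : central c -> central (star c).
Proof. by move=> cc a; rewrite -[a]starK -!starM cc. Qed.

Lemma T_central : central T.
Proof. by apply: central_ind; [exact: T_star|exact: TZ_comm|exact: TW_comm|]. Qed.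

(** W passes Z^* at the cost of a factor q, and this factor is absorbed again when
    W passes Z. *)
Lemma Z2_central : central Z2.
Proof.
apply: central_ind; first exact: Z2_star.
- by rewrite {1}/Defs.Z2 -mulrA -Z_normal mulrA.
- have ZsW : star Z * W = q *: (W * star Z).
    rewrite -[W in LHS]starK -starM WsZ_comm starZ starM starK.
    by rewrite conjCK.
  by rewrite /Defs.Z2 -mulrA ZsW scal_mulAr !mulrA WZ_comm -scal_mulAl.
- by rewrite T_central.
Qed.

Lemma centralD a b : central a -> central b -> central (a + b).
Proof. by move=> ca cb x; rewrite mulrDl mulrDr ca cb. Qed.
Lemma centralZ (k : R[i]) a : central a -> central (k *: a).
Proof. by move=> ca x; rewrite scal_mulAl scal_mulAr ca. Qed.
Lemma centralM a b : central a -> central b -> central (a * b).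
Proof. by move=> ca cb x; rewrite -mulrA cb mulrA ca mulrA. Qed.
Lemma central1 : central 1. Proof. by move=> x; rewrite mulr1 mul1r. Qed.
Lemma centralV a b : a * b = 1 -> b * a = 1 -> central a -> central b.
Proof.
move=> ab ba ca x.
by rewrite -[x * b]mul1r -ba -mulrA (mulrA a) ca -(mulrA x) ab mulr1.
Qed.
Lemma centralX a n : central a -> central (a ^+ n).
Proof.
move=> ca; elim: n => [|n IH]; first by rewrite expr0; exact: central1.
by rewrite exprS; exact: centralM.
Qed.

(** By the sphere relation, |W|^2 is a polynomial in the central elements T and
    |Z|^2. *)
Lemma W2_central : central W2.
Proof.
rewrite W2E; apply: centralD; last first.
  by rewrite -scaleN1r; apply: centralZ; exact: Z2_central.
apply: centralD; first exact: central1.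
by rewrite -scaleN1r; apply/centralZ/centralX; exact: T_central.
Qed.

Lemma Z2_inv_r : Z2 * Z2inv theta = 1.
Proof. by rewrite -[RHS](locinv_r (S4m_Z theta)) tolocM toloc_star. Qed.
Lemma Z2_inv_l : Z2inv theta * Z2 = 1.
Proof. by rewrite -[RHS](locinv_l (S4m_Z theta)) tolocM toloc_star. Qed.
Lemma W2_inv_r : W2 * W2inv theta = 1.
Proof. by rewrite -[RHS](locinv_r (S4m_W theta)) tolocM toloc_star. Qed.
Lemma W2_inv_l : W2inv theta * W2 = 1.
Proof. by rewrite -[RHS](locinv_l (S4m_W theta)) tolocM toloc_star. Qed.
Lemma toloc_1mT2 : toloc (@S4mult _ theta) (1 - T0 theta ^+ 2) = 1 - T ^+ 2.
Proof.
by rewrite -scaleN1r tolocD tolocZ toloc1 scaleN1r !expr2 tolocM.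
Qed.
Lemma toloc_1pT2 : toloc (@S4mult _ theta) (1 + T0 theta ^+ 2) = 1 + T ^+ 2.
Proof. by rewrite tolocD toloc1 !expr2 tolocM. Qed.
Lemma mT2_inv_r : (1 - T ^+ 2) * mT2inv theta = 1.
Proof. by rewrite -[RHS](locinv_r (S4m_mT theta)) toloc_1mT2. Qed.
Lemma mT2_inv_l : mT2inv theta * (1 - T ^+ 2) = 1.
Proof. by rewrite -[RHS](locinv_l (S4m_mT theta)) toloc_1mT2. Qed.
Lemma pT2_inv_r : (1 + T ^+ 2) * pT2inv theta = 1.
Proof. by rewrite -[RHS](locinv_r (S4m_pT theta)) toloc_1pT2. Qed.
Lemma pT2_inv_l : pT2inv theta * (1 + T ^+ 2) = 1.
Proof. by rewrite -[RHS](locinv_l (S4m_pT theta)) toloc_1pT2. Qed.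

Lemma mT2_central : central (1 - T ^+ 2).
Proof.
rewrite -scaleN1r; apply: centralD; first exact: central1.
by apply/centralZ/centralX; exact: T_central.
Qed.

Lemma Zloc_central a : Zloc a -> central a.
Proof.
elim=> *.
- exact: central1.
- exact: Z2_central.
- exact: centralV Z2_inv_r Z2_inv_l Z2_central.
- exact: W2_central.
- exact: centralV W2_inv_r W2_inv_l W2_central.
- exact: T_central.
- exact: centralV mT2_inv_r mT2_inv_l mT2_central.
- apply: centralV pT2_inv_r pT2_inv_l _.
  by apply: centralD; [exact: central1|apply/centralX/T_central].
- exact: centralD.
- exact: centralZ.
- exact: centralM.
Qed.

End Relations.

(** * Hermitian derivations *)

Section Derivations.
Variables (R : realType) (theta : R).
Local Notation A := (S4loc theta).
Local Notation Z := (Z theta).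
Local Notation W := (W theta).
Local Notation T := (T theta).
Local Notation Z2 := (Z2 theta).
Local Notation W2 := (W2 theta).
Local Notation hder := (@hermitian_derivation R theta).
Implicit Types (a b c : A) (d : A -> A).

Lemma derD d a b : hder d -> d (a + b) = d a + d b.
Proof. by case=> -[]. Qed.
Lemma derZ d (k : R[i]) a : hder d -> d (k *: a) = k *: d a.
Proof. by case=> -[]. Qed.
Lemma derM d a b : hder d -> d (a * b) = d a * b + a * d b.
Proof. by case=> -[]. Qed.
Lemma der_star d a : hder d -> d (star a) = star (d a).
Proof. by case. Qed.
Lemma derN d a : hder d -> d (- a) = - d a.
Proof. by move=> hd; rewrite -scaleN1r derZ // scaleN1r. Qed.
Lemma derB d a b : hder d -> d (a - b) = d a - d b.
Proof. by move=> hd; rewrite derD // derN. Qed.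
Lemma der1 d : hder d -> d 1 = 0.
Proof.
move=> hd; have := derM 1 1 hd; rewrite !mulr1 mul1r => /eqP.
by rewrite -subr_eq0 opprD addrA subrr sub0r oppr_eq0 => /eqP.
Qed.
Lemma der0 d : hder d -> d 0 = 0.
Proof. by move=> hd; rewrite -{1}[0](scale0r (1 : A)) derZ // scale0r. Qed.
(** Differentiate a * b = 1. *)
Lemma derV d a b : hder d -> a * b = 1 -> b * a = 1 -> d b = - (b * d a * b).
Proof.
move=> hd ab ba; have := derM a b hd; rewrite ab der1 // => /esym/eqP.
rewrite addr_eq0 => /eqP dab.
by rewrite -mulrA dab mulrN opprK mulrA ba mul1r.
Qed.

(** The equality is one of functions: the connection and the map varphi take
    derivations as arguments, and a bracket has to be rewritten there into a
    combination of the spanning derivations. *)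
Lemma der_ext d d' : hder d -> hder d' -> d Z = d' Z -> d W = d' W -> d T = d' T ->
  d = d'.
Proof.
move=> hd hd' eZ eW eT; apply/funext; elim/S4loc_ind => //.
- by rewrite (der1 hd) (der1 hd').
- by move=> a b ea eb; rewrite (derD _ _ hd) (derD _ _ hd') ea eb.
- by move=> k a ea; rewrite (derZ _ _ hd) (derZ _ _ hd') ea.
- by move=> a b ea eb; rewrite (derM _ _ hd) (derM _ _ hd') ea eb.
- by move=> a ea; rewrite (der_star _ hd) (der_star _ hd') ea.
- by move=> a b ab ba ea; rewrite (derV hd ab ba) (derV hd' ab ba) ea.
Qed.

Lemma hd_central_mul c d : central c -> star c = c -> hder d -> hder (fun x => c * d x).
Proof.
move=> cc cs hd; split; [split|].
- by move=> a b; rewrite (derD _ _ hd) mulrDr.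
- by move=> k a; rewrite (derZ _ _ hd) scal_mulAr.
- by move=> a b; rewrite (derM _ _ hd) mulrDr !mulrA (cc a).
- by move=> a; rewrite (der_star _ hd) starM cs cc.
Qed.

Lemma hd_bracket d d' : hder d -> hder d' -> hder (bracket d d').
Proof.
move=> hd hd'; split; [split|] => *; rewrite /bracket.
- by rewrite (derD _ _ hd') (derD _ _ hd) (derD _ _ hd) (derD _ _ hd') opprD addrACA.
- by rewrite (derZ _ _ hd') (derZ _ _ hd) (derZ _ _ hd) (derZ _ _ hd') scalerBr.
- rewrite (derM _ _ hd') (derM _ _ hd) (derD _ _ hd) (derD _ _ hd') 
    !(derM _ _ hd) !(derM _ _ hd') mulrBl mulrBr.
  have zmodE (x u v s y t : A) : x + u + (v + s) - (y + v + (u + t)) = x - y + (s - t).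
    rewrite (addrC x) (addrC y) [u + x + _]addrACA [v + y + _]addrACA (addrC v).
    by rewrite opprD [LHS]addrACA subrr add0r opprD [LHS]addrACA.
  exact: zmodE.
- by rewrite (der_star _ hd') (der_star _ hd) (der_star _ hd) (der_star _ hd') starB.
Qed.

Variables dt1 dt2 dt3 dt4 : A -> A.
Hypothesis Hdt : is_dtilde dt1 dt2 dt3 dt4.
Local Notation pd := (pd dt1 dt2 dt3 dt4).

Definition o0 : 'I_4 := @Ordinal 4 0 isT.
Definition o1 : 'I_4 := @Ordinal 4 1 isT.
Definition o2 : 'I_4 := @Ordinal 4 2 isT.
Definition o3 : 'I_4 := @Ordinal 4 3 isT.

Lemma ord4P (P : 'I_4 -> Prop) : P o0 -> P o1 -> P o2 -> P o3 -> forall i, P i.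
Proof.
move=> P0 P1 P2 P3 [[|[|[|[|//]]]] Hi].
- by rewrite (_ : Ordinal Hi = o0) //; exact: val_inj.
- by rewrite (_ : Ordinal Hi = o1) //; exact: val_inj.
- by rewrite (_ : Ordinal Hi = o2) //; exact: val_inj.
- by rewrite (_ : Ordinal Hi = o3) //; exact: val_inj.
Qed.

Lemma sum4 (V : nmodType) (F : 'I_4 -> V) :
  \sum_e F e = F o0 + F o1 + F o2 + F o3.
Proof.
rewrite !big_ord_recr big_ord0 /= add0r.
by do ![congr (_ + _)]; congr F; exact: val_inj.
Qed.

Lemma pd_o0 : pd o0 = (fun x => (1 - T ^+ 2) * dt1 x).
Proof. by apply/funext => x; rewrite /Defs.pd /tnth /= /d1 expr0 mul1r. Qed.
Lemma pd_o1 : pd o1 = (fun x => (1 - T ^+ 2) * dt2 x).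
Proof. by apply/funext => x; rewrite /Defs.pd /tnth /= /d2 expr0 mul1r. Qed.
Lemma pd_o2 : pd o2 = dt3.
Proof. by apply/funext => x; rewrite /Defs.pd /tnth /= /d3 expr0 mul1r. Qed.
Lemma pd_o3 : pd o3 = dt4.
Proof. by []. Qed.

Lemma mT2_star : star (1 - T ^+ 2) = 1 - T ^+ 2.
Proof. by rewrite starB star1 starX T_star. Qed.

Lemma pd_hd i : hder (pd i).
Proof.
elim/ord4P: i; rewrite ?pd_o0 ?pd_o1 ?pd_o2 ?pd_o3; [| | |by case: Hdt].
- by apply: hd_central_mul; [exact: mT2_central|exact: mT2_star|case: Hdt].
- by apply: hd_central_mul; [exact: mT2_central|exact: mT2_star|case: Hdt].
- by case: Hdt.
Qed.

Lemma pd_T i : pd i T = if i == o3 then T ^+ 2 - 1 else 0.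
Proof.
case: Hdt => _ _ _ _ [_ _ e1] [_ _ e2] [_ _ e3] [_ _ e4].
elim/ord4P: i; rewrite ?pd_o0 ?pd_o1 ?pd_o2 ?pd_o3 ?e1 ?e2 ?e3 ?e4 /=.
all: by rewrite ?mulr0.
Qed.

(** Each frame derivation multiplies Z and W by a central element: the first two
    rotate Z and W, the third shifts weight between |Z|^2 and |W|^2, the fourth
    moves along the meridians. *)
Definition rateZ (i : 'I_4) : A :=
  nth 0 [:: ('i : R[i]) *: (1 - T ^+ 2); 0; W2; T] i.
Definition rateW (i : 'I_4) : A :=
  nth 0 [:: 0; ('i : R[i]) *: (1 - T ^+ 2); - Z2; T] i.

Lemma rateZ_central i : central (rateZ i).
Proof.
elim/ord4P: i; rewrite /rateZ /=.
- by apply/centralZ/mT2_central.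
- by rewrite -[0](scale0r (1 : A)); apply/centralZ/central1.
- exact: W2_central.
- exact: T_central.
Qed.

Lemma rateW_central i : central (rateW i).
Proof.
elim/ord4P: i; rewrite /rateW /=.
- by rewrite -[0](scale0r (1 : A)); apply/centralZ/central1.
- by apply/centralZ/mT2_central.
- by rewrite -scaleN1r; apply/centralZ/Z2_central.
- exact: T_central.
Qed.

Lemma pd_Z i : pd i Z = Z * rateZ i.
Proof.
case: Hdt => _ _ _ _ [e1 _ _] [e2 _ _] [e3 _ _] [e4 _ _].
elim/ord4P: i; rewrite ?pd_o0 ?pd_o1 ?pd_o2 ?pd_o3 ?e1 ?e2 ?e3 ?e4 /rateZ /= ?mulr0 //.
by rewrite !scal_mulAr mT2_central.
Qed.

Lemma pd_W i : pd i W = W * rateW i.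
Proof.
case: Hdt => _ _ _ _ [_ e1 _] [_ e2 _] [_ e3 _] [_ e4 _].
elim/ord4P: i; rewrite ?pd_o0 ?pd_o1 ?pd_o2 ?pd_o3 ?e1 ?e2 ?e3 ?e4 /rateW /=
  ?mulr0 ?mulrN //.
by rewrite !scal_mulAr mT2_central.
Qed.

(** The rotations drop out here, as their rates are antihermitian. *)
Lemma pd_normsq i x l : central l -> pd i x = x * l ->
  pd i (x * star x) = x * star x * (l + star l).
Proof.
move=> cl e; rewrite (derM _ _ (pd_hd i)) (der_star _ (pd_hd i)) e starM.
by rewrite -mulrA cl mulrA (central_star cl) mulrA [RHS]mulrDr.
Qed.

Lemma pd_Z2 i : pd i Z2 = Z2 * (rateZ i + star (rateZ i)).
Proof. exact: pd_normsq (rateZ_central i) (pd_Z i). Qed.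

Lemma pd_W2 i : pd i W2 = W2 * (rateW i + star (rateW i)).
Proof. exact: pd_normsq (rateW_central i) (pd_W i). Qed.

End Derivations.

(** * The commutative ring Z_loc *)

Section Zring.
Variables (R : realType) (theta : R).
Definition Zmem : {pred S4loc theta} := fun a => `[< Zloc a >].

Lemma ZmemP a : reflect (Zloc a) (a \in Zmem).
Proof. exact: asboolP. Qed.

Lemma Zmem_subring : subring_closed Zmem.
Proof.
split.
- by apply/ZmemP; exact: Zl_one.
- move=> a b /ZmemP Za /ZmemP Zb; apply/ZmemP; rewrite -scaleN1r.
  by apply: Zl_add => //; exact: Zl_scale.
- by move=> a b /ZmemP Za /ZmemP Zb; apply/ZmemP; exact: Zl_mul.
Qed.

(** A type of its own gives Z_loc a commutative ring structure, so that the ring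
    tactic applies. It may a priori be the zero ring, hence a comPzRingType. *)
Record Zring := MkZring { zval :> S4loc theta; _ : zval \in Zmem }.
HB.instance Definition _ := [isSub for zval].
HB.instance Definition _ := [Choice of Zring by <:].
HB.instance Definition _ := GRing.SubChoice_isSubPzRing.Build _ _ Zring Zmem_subring.

Lemma zvalP (x : Zring) : Zloc (zval x).
Proof. by case: x => x /= /ZmemP. Qed.

Lemma Zring_mulC : @commutative Zring _ *%R.
Proof.
move=> x y; apply: val_inj; rewrite !rmorphM /=.
exact: Zloc_central (zvalP x) _.
Qed.
HB.instance Definition _ := GRing.PzSemiRing_hasCommutativeMul.Build Zring Zring_mulC.

Definition zring (a : S4loc theta) (Za : Zloc a) : Zring :=
  MkZring (introT (ZmemP a) Za).

Lemma zval_inj : injective zval. Proof. exact: val_inj. Qed.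
Lemma zvalD (x y : Zring) : zval (x + y) = zval x + zval y. Proof. by []. Qed.
Lemma zvalN (x : Zring) : zval (- x) = - zval x. Proof. by []. Qed.
Lemma zvalM (x y : Zring) : zval (x * y) = zval x * zval y. Proof. by []. Qed.
Lemma zval1 : zval 1 = 1. Proof. by []. Qed.
Lemma zval0 : zval 0 = 0. Proof. by []. Qed.
Lemma zvalMn (x : Zring) n : zval (x *+ n) = zval x *+ n.
Proof. exact: (raddfMn (val : Zring -> S4loc theta)). Qed.
Lemma zvalX (x : Zring) n : zval (x ^+ n) = zval x ^+ n.
Proof. exact: (rmorphXn (val : Zring -> S4loc theta)). Qed.
Lemma zval_sum (I : Type) (r : seq I) (P : pred I) (F : I -> Zring) :
  zval (\sum_(i <- r | P i) F i) = \sum_(i <- r | P i) zval (F i).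
Proof. exact: (raddf_sum (val : Zring -> S4loc theta)). Qed.

Lemma zval_comm (x : Zring) a : zval x * a = a * zval x.
Proof. exact: Zloc_central (zvalP x) a. Qed.

(** Elements with an inverse in Z_loc can be cancelled in the full algebra. *)
Lemma zval_mulI (x xi : Zring) a b :
  x * xi = 1 -> zval x * a = zval x * b -> a = b.
Proof.
move=> e /(congr1 (fun y => zval xi * y)).
by rewrite !mulrA -!zvalM mulrC e zval1 !mul1r.
Qed.

Lemma S4loc_mul2I (a b : S4loc theta) : a *+ 2 = b *+ 2 -> a = b.
Proof.
rewrite -(scaler_nat 2 a) -(scaler_nat 2 b) => /(congr1 (GRing.scale (2%:R^-1))).
by rewrite !scalerA mulVf ?pnatr_eq0 // !scale1r.
Qed.

Lemma Zring_mul2I (x y : Zring) : x *+ 2 = y *+ 2 -> x = y.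
Proof.
by move=> /(congr1 zval); rewrite !zvalMn => /S4loc_mul2I/zval_inj.
Qed.

Lemma Zl_0 : Zloc (0 : S4loc theta).
Proof. exact: zvalP (0 : Zring). Qed.
Lemma Zl_opp (a : S4loc theta) : Zloc a -> Zloc (- a).
Proof. by move=> Za; exact: zvalP (- zring Za). Qed.

Definition zZ2 : Zring := zring (Zl_Z2 theta).
Definition zT : Zring := zring (Zl_T theta).
Definition zZ2i : Zring := zring (Zl_Z2inv theta).
Definition zW2i : Zring := zring (Zl_W2inv theta).
Definition zmTi : Zring := zring (Zl_mT2inv theta).
Definition zi : Zring := zring (Zl_scale 'i (Zl_one theta)).
(** With |W|^2 written through T and |Z|^2, the ring tactic works modulo the sphere
    relation. *)
Definition zW2 : Zring := 1 - zT ^+ 2 - zZ2.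

Lemma zW2E : zval zW2 = W2 theta.
Proof. by rewrite W2E !(zvalD, zvalN) zvalX. Qed.
Lemma zmTE : zval (1 - zT ^+ 2) = 1 - T theta ^+ 2.
Proof. by rewrite zvalD zvalN zvalX. Qed.
Lemma zZ2K : zZ2 * zZ2i = 1.
Proof. by apply: zval_inj; exact: Z2_inv_r. Qed.
Lemma zW2K : zW2 * zW2i = 1.
Proof. by apply: zval_inj; rewrite zvalM zW2E; exact: W2_inv_r. Qed.
Lemma zmTK : (1 - zT ^+ 2) * zmTi = 1.
Proof. by apply: zval_inj; rewrite zvalM zmTE; exact: mT2_inv_r. Qed.

Section Der.
Variables dt1 dt2 dt3 dt4 : S4loc theta -> S4loc theta.
Hypothesis Hdt : is_dtilde dt1 dt2 dt3 dt4.
Local Notation pd := (pd dt1 dt2 dt3 dt4).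

Definition zrateZ (i : 'I_4) : Zring := nth 0 [:: zi * (1 - zT ^+ 2); 0; zW2; zT] i.
Definition zrateW (i : 'I_4) : Zring := nth 0 [:: 0; zi * (1 - zT ^+ 2); - zZ2; zT] i.
Definition znormrateZ (i : 'I_4) : Zring := nth 0 [:: 0; 0; zW2; zT] i *+ 2.
Definition znormrateW (i : 'I_4) : Zring := nth 0 [:: 0; 0; - zZ2; zT] i *+ 2.

Lemma zrateZE i : zval (zrateZ i) = rateZ theta i.
Proof.
elim/ord4P: i => //; last exact: zW2E.
by rewrite /zrateZ /rateZ zvalM zmTE scal_mulAl mul1r.
Qed.
Lemma zrateWE i : zval (zrateW i) = rateW theta i.
Proof.
elim/ord4P: i => //.
by rewrite /zrateW /rateW zvalM zmTE scal_mulAl mul1r.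
Qed.

Lemma pd_Z2K i : pd i (Z2 theta) = zval (zZ2 * znormrateZ i).
Proof.
rewrite (pd_Z2 Hdt) zvalM zvalMn mulr2n; congr (_ * _).
elim/ord4P: i.
- rewrite -[rateZ theta o0]/('i *: (1 - T theta ^+ 2)) starZ mT2_star.
  by rewrite conjCi scaleNr subrr addr0.
- by rewrite -[rateZ theta o1]/0 star0.
- by rewrite -[rateZ theta o2]/(W2 theta) W2_star -zW2E.
- by rewrite -[rateZ theta o3]/(T theta) T_star.
Qed.
Lemma pd_W2K i : pd i (W2 theta) = zval (zW2 * znormrateW i).
Proof.
rewrite (pd_W2 Hdt) zvalM zvalMn mulr2n zW2E; congr (_ * _).
elim/ord4P: i.
- by rewrite -[rateW theta o0]/0 star0.
- rewrite -[rateW theta o1]/('i *: (1 - T theta ^+ 2)) starZ mT2_star.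
  by rewrite conjCi scaleNr subrr addr0.
- rewrite -[rateW theta o2]/(- Z2 theta).
  by rewrite -scaleN1r starZ rmorphN rmorph1 Z2_star scaleN1r.
- by rewrite -[rateW theta o3]/(T theta) T_star.
Qed.
Lemma pd_TK i : pd i (T theta) = zval (if i == o3 then zT ^+ 2 - 1 else 0).
Proof. by rewrite (pd_T Hdt); case: ifP => _; rewrite ?zvalD ?zvalX. Qed.

Lemma Zl_derV d (a b : S4loc theta) : hermitian_derivation d ->
  a * b = 1 -> b * a = 1 -> Zloc b -> Zloc (d a) -> Zloc (d b).
Proof.
move=> hd ab ba Zb Zda; rewrite (derV hd ab ba).
by apply/Zl_opp; do 2?apply: Zl_mul.
Qed.

Lemma pd_Zloc i (a : S4loc theta) : Zloc a -> Zloc (pd i a).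
Proof.
have hd := pd_hd Hdt i.
have ZT2 : Zloc (pd i (T theta ^+ 2)).
  rewrite expr2 (derM _ _ hd) pd_TK; apply: Zl_add; apply: Zl_mul;
    by [exact: Zl_T|exact: zvalP].
elim.
- by rewrite (der1 hd); exact: Zl_0.
- by rewrite pd_Z2K; exact: zvalP.
- apply: (Zl_derV hd (Z2_inv_r _) (Z2_inv_l _) (Zl_Z2inv _)).
  by rewrite pd_Z2K; exact: zvalP.
- by rewrite pd_W2K; exact: zvalP.
- apply: (Zl_derV hd (W2_inv_r _) (W2_inv_l _) (Zl_W2inv _)).
  by rewrite pd_W2K; exact: zvalP.
- by rewrite pd_TK; exact: zvalP.
- apply: (Zl_derV hd (mT2_inv_r _) (mT2_inv_l _) (Zl_mT2inv _)).
  by rewrite (derB _ _ hd) (der1 hd) sub0r; exact: Zl_opp.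
- apply: (Zl_derV hd (pT2_inv_r _) (pT2_inv_l _) (Zl_pT2inv _)).
  by rewrite (derD _ _ hd) (der1 hd) add0r.
- by move=> x y _ Zx _ Zy; rewrite (derD _ _ hd); exact: Zl_add.
- by move=> k x _ Zx; rewrite (derZ _ _ hd); exact: Zl_scale.
- by move=> x y Zx Zdx Zy Zdy; rewrite (derM _ _ hd); apply: Zl_add; exact: Zl_mul.
Qed.

Definition zder (i : 'I_4) (x : Zring) : Zring := zring (pd_Zloc i (zvalP x)).

Lemma zderE i x : zval (zder i x) = pd i (zval x). Proof. by []. Qed.
Lemma zder_add i x y : zder i (x + y) = zder i x + zder i y.
Proof. by apply: zval_inj; rewrite /= (derD _ _ (pd_hd Hdt i)). Qed.
Lemma zder_mul i x y : zder i (x * y) = zder i x * y + x * zder i y.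
Proof. by apply: zval_inj; rewrite /= (derM _ _ (pd_hd Hdt i)). Qed.
Lemma zder_Z2 i : zder i zZ2 = zZ2 * znormrateZ i.
Proof. by apply: zval_inj; rewrite zderE /= pd_Z2K. Qed.
Lemma zder_T i : zder i zT = if i == o3 then zT ^+ 2 - 1 else 0.
Proof. by apply: zval_inj; rewrite zderE /= pd_TK. Qed.
Lemma zder_i i : zder i zi = 0.
Proof.
have hd := pd_hd Hdt i.
by apply: zval_inj; rewrite zderE /= (derZ _ _ hd) (der1 hd) scaler0.
Qed.

End Der.

End Zring.

(** * Christoffel symbols and curvature over a commutative ring *)

Section Calculus.
Variables (K : comPzRingType) (z t : K).
Let w := 1 - t ^+ 2 - z.

(** The bracket of the frame derivations i and j is brcoef i j times the frame
    derivation brdir i j: it vanishes unless exactly one of them is the fourth,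
    and then the other one is reproduced with the factor 2 T or - 2 T. Whenever
    the coefficient is 0, the direction is arbitrary. *)
Definition brcoef (i j : 'I_4) : K :=
  if i == o3 then (if j == o3 then 0 else t *+ 2)
  else if j == o3 then - (t *+ 2) else 0.
Definition brdir (i j : 'I_4) : 'I_4 := if i == o3 then j else i.

(** The metric entries divided by their common factor delta (1 - T^2). *)
Definition mdiag (c : 'I_4) : K :=
  nth 0 [:: z * (1 - t ^+ 2); w * (1 - t ^+ 2); z * w; 1] c.

Variables (dl al be : K).
Definition hdiag (c : 'I_4) : K := dl * (1 - t ^+ 2) * mdiag c.

(** Rows that are too short are read with the default value 0. Here z and t stand
    for |Z|^2 and T, and al for half the logarithmic derivative of the conformal
    factor along the fourth frame derivation; chris i b c is the coefficient of
    E_c in the covariant derivative of E_b along the derivation i. *)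
Definition chris (i b c : 'I_4) : K :=
  let u := 1 - t ^+ 2 in let f := al + t in let g := f + t *+ 2 in
  nth 0 (nth [::] (nth [::]
   [:: [:: [:: 0; 0; - u; - (f * z * u)]; [::]; [:: w]; [:: f]];
       [:: [::]; [:: 0; 0; u; - (f * w * u)]; [:: 0; - z]; [:: 0; f]];
       [:: [:: w]; [:: 0; - z]; [:: 0; 0; w - z; - (f * z * w)]; [:: 0; 0; f]];
       [:: [:: g]; [:: 0; g]; [:: 0; 0; g]; [:: 0; 0; 0; f]]] i) b) c.

(** The sectional curvatures, up to the common factor delta (1 - T^2): a plane
    that contains the fourth direction is radial, the others are tangent to a
    slice of constant T. The element be is the derivative of al along the fourth
    frame derivation. *)
Definition kcurv (p q : 'I_4) : K :=
  if (p == o3) || (q == o3) then - (be + t ^+ 2 - 1) else 1 - (al + t) ^+ 2.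

(** The curvature tensor with its first index raised. *)
Definition Rmix (a b p q : 'I_4) : K :=
  kcurv p q * ((if (a == p) && (q == b) then mdiag q else 0)
           - (if (a == q) && (p == b) then mdiag p else 0)).

Variable D : 'I_4 -> K -> K.
Hypothesis DD : forall i x y, D i (x + y) = D i x + D i y.
Hypothesis DM : forall i x y, D i (x * y) = D i x * y + x * D i y.
Hypothesis Dz : forall i, D i z = z * (nth 0 [:: 0; 0; w; t] i *+ 2).
Hypothesis Dt : forall i, D i t = if i == o3 then t ^+ 2 - 1 else 0.
Hypothesis Ddl : forall i, D i dl = if i == o3 then al * dl *+ 2 else 0.
Hypothesis Dal : forall i, D i al = if i == o3 then be else 0.

Let D0 i : D i 0 = 0.
Proof.
have /eqP := DD i 0 0; rewrite addr0 -subr_eq0 opprD addrA subrr sub0r.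
by rewrite oppr_eq0 => /eqP.
Qed.
Let D1 i : D i 1 = 0.
Proof.
have /eqP := DM i 1 1; rewrite !mulr1 mul1r -subr_eq0 opprD addrA subrr sub0r.
by rewrite oppr_eq0 => /eqP.
Qed.
Let DN i x : D i (- x) = - D i x.
Proof. by apply/eqP; rewrite -addr_eq0 -DD addNr D0. Qed.

Let Dmt j : D j (1 - t ^+ 2) = if j == o3 then (1 - t ^+ 2) * t *+ 2 else 0.
Proof. by rewrite DD D1 DN expr2 DM Dt; case: ifP => _; ring. Qed.
Let Dw j : D j w = w * (nth 0 [:: 0; 0; - z; t] j *+ 2).
Proof. rewrite DD Dmt DN Dz; move: j; apply: ord4P; rewrite /= /w; ring. Qed.

Let Dmdiag j k : D j (mdiag k) = mdiag k * (nth 0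
  [:: 0; 0; nth 0 [:: w; - z; w - z; 0] k; nth 0 [:: t *+ 2; t *+ 2; t *+ 2; 0] k]
  j *+ 2).
Proof.
move: k; apply: ord4P; rewrite /mdiag /= ?D1 ?(DM, Dmt, Dz, Dw);
by move: j; apply: ord4P; rewrite /= /w; ring.
Qed.

(** The metric entries are eigenvectors of the derivations: every derivative
    of hdiag k is a multiple of hdiag k, so the Koszul formula can be divided
    by the metric without leaving the ring. *)
Lemma D_hdiag j k : D j (hdiag k) = hdiag k * (nth 0
  [:: 0; 0; nth 0 [:: w; - z; w - z; 0] k;
      nth 0 [:: t *+ 2; t *+ 2; t *+ 2; 0] k + al + t] j *+ 2).
Proof.
rewrite /hdiag !DM Dmdiag Dmt Ddl.
by move: j k; do 2!apply: ord4P; rewrite /=; ring.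
Qed.

(** The left-hand side is the Koszul expression of three frame fields: with an
    orthogonal frame, only the derivatives of the diagonal metric entries and
    the structure constants of the frame contribute. *)
Lemma koszul_chris (i b c : 'I_4) :
  (if b == c then D i (hdiag b) else 0) + (if c == i then D b (hdiag i) else 0)
  - (if i == b then D c (hdiag i) else 0)
  + hdiag c * (if c == brdir i b then brcoef i b else 0)
  - hdiag i * (if i == brdir b c then brcoef b c else 0)
  - hdiag b * (if b == brdir i c then brcoef i c else 0)
  = hdiag c * chris i b c *+ 2.
Proof.
rewrite !D_hdiag; move: i b c; do 3!apply: ord4P;
rewrite /brdir /brcoef /hdiag /mdiag /chris /= /w; ring.
Qed.

(** Written with Christoffel symbols, the curvature operator of two frame fields
    maps their plane to itself and annihilates the complement, as it does for
    every rotationally symmetric metric. *)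
Lemma curv_chris (p q b a : 'I_4) :
  D p (chris q b a) + \sum_e chris p e a * chris q b e
  - (D q (chris p b a) + \sum_e chris q e a * chris p b e)
  - brcoef p q * chris (brdir p q) b a = Rmix a b p q.
Proof.
rewrite !sum4; move: b a; do 2!apply: ord4P; move: p q; do 2!apply: ord4P;
rewrite /brdir /brcoef /Rmix /kcurv /mdiag /chris /=
  ?(Dmt, Dw, DD, DM, DN, D0, D1, Dz, Dt, Dal) /= /w; ring.
Qed.

End Calculus.

(** * The Gauss-Bonnet polynomial of a diagonal curvature operator *)

Section GBSum.
Variables (K : comPzRingType) (h hi : 'I_4 -> K) (kr kt : K).
Hypothesis hK : forall a, h a * hi a = 1.

(** The curvature tensor whose operator has the eigenvalue kr on the planes that
    contain the fourth direction and kt on the other ones; h is the diagonal of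
    the metric. *)
Definition ksec (p q : 'I_4) : K := if (p == o3) || (q == o3) then kr else kt.
Definition Rdiag (a b p q : 'I_4) : K :=
  ksec p q * ((if (a == p) && (q == b) then h p * h q else 0)
            - (if (a == q) && (p == b) then h p * h q else 0)).
Definition idiag (a b : 'I_4) : K := if a == b then hi a else 0.

Lemma sum_idiag a (F : 'I_4 -> K) : \sum_p idiag a p * F p = hi a * F a.
Proof.
rewrite (bigD1 a) //= big1 ?addr0 /idiag ?eqxx // => p pa.
by rewrite eq_sym (negPf pa) mul0r.
Qed.

Lemma gb_Rup a b c d :
  \sum_p \sum_q \sum_r \sum_s
    idiag a p * idiag b q * idiag c r * idiag d s * Rdiag p q r s
  = hi a * hi b * hi c * hi d * Rdiag a b c d.
Proof.
under eq_bigr do under eq_bigr do under eq_bigr do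
  (under eq_bigr do rewrite -!mulrA; rewrite -!mulr_sumr).
under eq_bigr do under eq_bigr do rewrite -!mulr_sumr.
under eq_bigr do rewrite -!mulr_sumr.
rewrite sum_idiag sum_idiag; do 2![under eq_bigr do rewrite ?sum_idiag].
by rewrite sum_idiag !mulrA.
Qed.

Lemma gb_Ric a b :
  \sum_p \sum_q idiag p q * Rdiag a p b q
  = if a == b then h a * (if a == o3 then kr *+ 3 else kt *+ 2 + kr) else 0.
Proof.
under eq_bigr do rewrite sum_idiag.
rewrite sum4 /Rdiag /ksec.
have := (hK o0, hK o1, hK o2, hK o3) => -[[[h0 h1] h2] h3].
by move: a b; do 2!apply: ord4P; rewrite /=; ring: h0 h1 h2 h3.
Qed.

(** Each of the three planes of either kind occurs with four orderings of its
    index pairs, whence the factor 12. *)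
Lemma gb_Kretschmann :
  \sum_a \sum_b \sum_c \sum_d
     (hi a * hi b * hi c * hi d * Rdiag a b c d) * Rdiag a b c d
  = (kr ^+ 2 + kt ^+ 2) *+ 12.
Proof.
have E a b c d : (hi a * hi b * hi c * hi d * Rdiag a b c d) * Rdiag a b c d
   = ksec c d ^+ 2 * ((if (a == c) && (d == b) then 1 else 0)
            - (if (a == d) && (c == b) then 1 else 0)) ^+ 2.
  rewrite /Rdiag.
  have ha := hK a; have hb := hK b; have hc := hK c; have hd := hK d.
  have [ac|_] := eqVneq a c; have [db|_] := eqVneq d b;
  have [ad|_] := eqVneq a d; have [cb|_] := eqVneq c b;
    by subst => //=; ring: ha hb hc hd.
under eq_bigr do under eq_bigr do under eq_bigr do under eq_bigr do rewrite E.
by rewrite !sum4 /ksec /=; ring.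
Qed.

(** The squares of kr and kt cancel: in dimension four the polynomial is, up to
    the factor 8, the sum over the three splittings into two complementary planes
    of the products of their curvatures, and each splitting has one plane of
    either kind. *)
Lemma gb_sum :
  \sum_a \sum_b \sum_c \sum_d
    (\sum_p \sum_q \sum_r \sum_s
      idiag a p * idiag b q * idiag c r * idiag d s * Rdiag p q r s) * Rdiag a b c d
  - (\sum_a \sum_b (\sum_p \sum_q idiag p q * Rdiag a p b q) *
      (\sum_p \sum_q idiag a p * idiag b q *
        (\sum_r \sum_s idiag r s * Rdiag p r q s))) *+ 4
  + (\sum_a \sum_b idiag a b * (\sum_p \sum_q idiag p q * Rdiag a p b q)) ^+ 2
  = kr * kt *+ 24.
Proof.
under eq_bigr do under eq_bigr do under eq_bigr do under eq_bigr do rewrite gb_Rup.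
rewrite gb_Kretschmann.
under eq_bigr do under eq_bigr do rewrite gb_Ric.
under [in X in _ + X]eq_bigr do rewrite sum_idiag gb_Ric eqxx.
have E a b : \sum_p \sum_q idiag a p * idiag b q *
      (\sum_r \sum_s idiag r s * Rdiag p r q s)
    = hi a * hi b *
      (if a == b then h a * (if a == o3 then kr *+ 3 else kt *+ 2 + kr) else 0).
  under eq_bigr do
    (under eq_bigr do rewrite gb_Ric -mulrA; rewrite -mulr_sumr sum_idiag).
  by rewrite sum_idiag mulrA.
under eq_bigr do under eq_bigr do rewrite E.
have := (hK o0, hK o1, hK o2, hK o3) => -[[[h0 h1] h2] h3].
rewrite !sum4 /=; ring: h0 h1 h2 h3.
Qed.

End GBSum.

(** * The module M and its metric *)

Section Module.
Variables (R : realType) (theta : R).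
Local Notation A := (S4loc theta).
Local Notation Z := (Z theta).
Local Notation W := (W theta).
Local Notation T := (T theta).
Local Notation Z2 := (Z2 theta).
Local Notation W2 := (W2 theta).
Local Notation K := (Zring theta).
Local Notation coord := (@Defs.coord R theta).

Lemma vmulDr (U : 'cV[A]_5) a b : vmul U (a + b) = vmul U a + vmul U b.
Proof. by apply/colP => i; rewrite !mxE mulrDr. Qed.
Lemma vmulDl (U V : 'cV[A]_5) a : vmul (U + V) a = vmul U a + vmul V a.
Proof. by apply/colP => i; rewrite !mxE mulrDl. Qed.
Lemma vmulA (U : 'cV[A]_5) a b : vmul (vmul U a) b = vmul U (a * b).
Proof. by apply/colP => i; rewrite !mxE mulrA. Qed.
Lemma vmul0 (U : 'cV[A]_5) : vmul U 0 = 0.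
Proof. by apply/colP => i; rewrite !mxE mulr0. Qed.
Lemma vmul1 (U : 'cV[A]_5) : vmul U 1 = U.
Proof. by apply/colP => i; rewrite !mxE mulr1. Qed.
Lemma vmul_suml (I : Type) (r : seq I) (P : pred I) (F : I -> 'cV[A]_5) a :
  vmul (\sum_(i <- r | P i) F i) a = \sum_(i <- r | P i) vmul (F i) a.
Proof.
apply: (big_morph (fun U => vmul U a)) => [U V|]; first exact: vmulDl.
by apply/colP => i; rewrite !mxE mul0r.
Qed.
Lemma vscale_vmul (r : R) (U : 'cV[A]_5) a :
  vscale r (vmul U a) = vmul U (r%:C *: a).
Proof. by apply/colP => i; rewrite !mxE scal_mulAr. Qed.

Lemma lincombD c c' : lincomb (c + c') = lincomb c + lincomb c' :> 'cV[A]_5.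
Proof. by rewrite -big_split; apply: eq_bigr => a _; rewrite mxE vmulDr. Qed.
Lemma lincombN c : lincomb (- c) = - lincomb c :> 'cV[A]_5.
Proof.
rewrite -sumrN; apply: eq_bigr => a _.
by apply/colP => i; rewrite !mxE mulrN.
Qed.
Lemma lincombB c c' : lincomb (c - c') = lincomb c - lincomb c' :> 'cV[A]_5.
Proof. by rewrite lincombD lincombN. Qed.
Lemma lincomb_vmul c a : vmul (lincomb c) a = lincomb (\col_i (c i 0 * a)) :> 'cV[A]_5.
Proof. by rewrite vmul_suml; apply: eq_bigr => i _; rewrite vmulA mxE. Qed.

(** Here x and y are the real and imaginary parts of a normal element when b is
    the adjoint of a. *)
Lemma rotation_normsq (a b : A) : a * b = b * a ->
  let x := (2^-1 : R[i]) *: (a + b) in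
  let y := ((2 * 'i)^-1 : R[i]) *: (a - b) in
  x * y = y * x /\ x * x + y * y = a * b.
Proof.
move=> ab x y.
have xE : x * x = (4^-1 : R[i]) *: (a * a + b * b + (a * b + a * b)).
  rewrite /x !(scal_mulAl, scal_mulAr) scalerA mulrDl !mulrDr -ab.
  rewrite -invfM; congr (_ *: _); first by congr (_^-1); ring.
  by rewrite (addrC (a * b) (b * b)) addrACA.
have yE : y * y = - (4^-1 : R[i]) *: (a * a + b * b + (- (a * b) - a * b)).
  rewrite /y !(scal_mulAl, scal_mulAr) scalerA mulrBl !mulrBr -ab.
  rewrite -invfM; congr (_ *: _).
    rewrite -invrN; congr (_^-1).
    have -> : (2 * 'i * (2 * 'i) : R[i]) = 4 * 'i ^+ 2 by ring.
    by rewrite sqrCi; ring.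
  by rewrite opprB addrACA.
split.
  rewrite /x /y !(scal_mulAl, scal_mulAr) !scalerA mulrC; congr (_ *: _).
  rewrite mulrDl mulrBl !mulrDr !mulrN -ab.
  by rewrite addrA subrK opprD addrA addrK.
rewrite xE yE scaleNr -scalerBr opprD addrACA subrr add0r opprD !opprK.
rewrite -!(mulr2n (_ * _)) -(mulr2n (_ *+ _)) -mulrnA.
by rewrite -(scaler_nat _ (a * b)) scalerA mulVf ?pnatr_eq0 // scale1r.
Qed.

(** The hypotheses say that the matrix with the rows (x, -y) and (y, x) maps
    (v, u) to 0; its determinant n is left invertible. *)
Lemma rotation_inj (x y n n' u v : A) : x * y = y * x -> x * x + y * y = n ->
  n' * n = 1 -> x * v = y * u -> x * u = - (y * v) -> u = 0 /\ v = 0.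
Proof.
move=> xy xxyy n'n xv xu.
have nu : n * u = 0.
  by rewrite -xxyy mulrDl -!mulrA xu -xv mulrN !mulrA xy addNr.
have nv : n * v = 0.
  have yv : y * v = - (x * u) by rewrite xu opprK.
  by rewrite -xxyy mulrDl -!mulrA xv yv mulrN !mulrA xy subrr.
by split; rewrite -[LHS]mul1r -n'n -mulrA ?nu ?nv mulr0.
Qed.

Lemma lincombE (c : 'cV[A]_4) i : lincomb c i 0 =
  E theta o0 i 0 * c o0 0 + E theta o1 i 0 * c o1 0
  + E theta o2 i 0 * c o2 0 + E theta o3 i 0 * c o3 0.
Proof.
by rewrite /lincomb summxE sum4; do ![congr (_ + _)]; rewrite [LHS]mxE.
Qed.

(** The fifth component isolates E_4. Without it, the components in the plane of
    Z see E_1 as the rotated and E_3 as the radial direction, and likewise E_2 and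
    E_3 in the plane of W. *)
Lemma lincomb_inj (c : 'cV[A]_4) : lincomb c = 0 -> c = 0.
Proof.
move=> /colP c0.
have mT2 := @mT2_central R theta; have mTi := mT2_inv_l theta.
have := c0 (@Ordinal 5 4 isT).
rewrite lincombE !mxE /= !mul0r !add0r => e4.
(* the component 5 is (T^2 - 1) times the coefficient of E_4 *)
have c3 : c o3 0 = 0.
  rewrite -[LHS]mul1r -mTi -mulrA -[1 - _]opprB mulNr e4.
  by rewrite oppr0 mulr0.
have := c0 (@Ordinal 5 0 isT).
rewrite lincombE !mxE /= c3 mul0r mulr0 !addr0 => e0.
have := c0 (@Ordinal 5 1 isT).
rewrite lincombE !mxE /= c3 mul0r mulr0 !addr0 => e1.
have := c0 (@Ordinal 5 2 isT).
rewrite lincombE !mxE /= c3 mul0r mulr0 !addr0 add0r => e2.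
have := c0 (@Ordinal 5 3 isT).
rewrite lincombE !mxE /= c3 mul0r mulr0 !addr0 add0r => e3.
have [x12 n12] := rotation_normsq (Z_normal theta).
have [x34 n34] := rotation_normsq (W_normal theta).
have [u0 _] : (1 - T ^+ 2) * c o0 0 = 0 /\ W2 * c o2 0 = 0.
  apply: (rotation_inj x12 n12 (Z2_inv_l theta)).
  - by move: e0; rewrite mulNr addrC => /eqP; rewrite subr_eq0 -!mulrA => /eqP.
  - by move: e1 => /eqP; rewrite addr_eq0 -!mulrA => /eqP.
have [v1 u1] : Z2 * c o2 0 = 0 /\ (1 - T ^+ 2) * c o1 0 = 0.
  apply: (rotation_inj x34 n34 (W2_inv_l theta)).
  - by move: e3; rewrite mulNr => /eqP; rewrite subr_eq0 -!mulrA => /eqP.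
  - move: e2; rewrite !mulNr addrC => /eqP.
    by rewrite subr_eq0 eqr_oppLR -!mulrA => /eqP.
apply/colP => i; rewrite mxE; move: i; apply: ord4P => //.
- by rewrite -[LHS]mul1r -mTi -mulrA u0 mulr0.
- by rewrite -[LHS]mul1r -mTi -mulrA u1 mulr0.
- by rewrite -[LHS]mul1r -(Z2_inv_l theta) -mulrA v1 mulr0.
Qed.

Lemma coord_lincomb (c : 'cV[A]_4) : coord (lincomb c) = c.
Proof.
have : (fun c' => lincomb c = lincomb c') (coord (lincomb c)).
  exact: (@xgetI _ 0 [set c' | lincomb c = lincomb c'] c erefl).
move=> /esym/eqP; rewrite -subr_eq0 -lincombB => /eqP/lincomb_inj/eqP.
by rewrite subr_eq0 => /eqP.
Qed.

Lemma inM_lincomb (c : 'cV[A]_4) : inM (lincomb c). Proof. by exists c. Qed.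

(** Combinations of the frame with coefficients in Z_loc. *)
Definition zcol (c : 'I_4 -> K) : 'cV[A]_4 := \col_a zval (c a).
Definition zlin (c : 'I_4 -> K) : 'cV[A]_5 := lincomb (zcol c).

Lemma E_zlin b : E theta b = zlin (fun a => if a == b then 1 else 0).
Proof.
rewrite /zlin /lincomb (bigD1 b) //= big1 ?addr0.
  by rewrite mxE eqxx vmul1.
by move=> a ab; rewrite mxE (negPf ab) vmul0.
Qed.

Lemma zlin_vmul c (a : K) : vmul (zlin c) (zval a) = zlin (fun b => c b * a).
Proof. by rewrite lincomb_vmul; congr lincomb; apply/colP => i; rewrite !mxE. Qed.

Lemma zlinD c c' : zlin (fun a => c a + c' a) = zlin c + zlin c'.
Proof. by rewrite -lincombD; congr lincomb; apply/colP => i; rewrite !mxE. Qed.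

Lemma zlinN c : zlin (fun a => - c a) = - zlin c.
Proof. by rewrite -lincombN; congr lincomb; apply/colP => i; rewrite !mxE. Qed.

Lemma zlin_E c : zlin c = \sum_a vmul (E theta a) (zval (c a)).
Proof. by apply: eq_bigr => a _; rewrite mxE. Qed.

Lemma zlin_inM c : inM (zlin c). Proof. exact: inM_lincomb. Qed.
Lemma E_inM b : inM (E theta b). Proof. by rewrite E_zlin; exact: zlin_inM. Qed.

Section Metric.
Variable dl : K.
Hypothesis dl_star : star (zval dl) = zval dl.
Local Notation h := (hdiag (zZ2 theta) (zT theta) dl).

Lemma mdiag_star c : star (zval (mdiag (zZ2 theta) (zT theta) c))
  = zval (mdiag (zZ2 theta) (zT theta) c).
Proof.
have sZ := Z2_star theta; have sW := W2_star theta; have sT := mT2_star theta.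
have zc (x y : K) : star (zval x) = zval x -> star (zval y) = zval y ->
    star (zval (x * y)) = zval (x * y).
  by move=> ex ey; rewrite zvalM starM ex ey zval_comm.
have eZ : star (zval (zZ2 theta)) = zval (zZ2 theta) by [].
have eW : star (zval (zW2 theta)) = zval (zW2 theta) by rewrite zW2E.
have eT : star (zval (1 - zT theta ^+ 2)) = zval (1 - zT theta ^+ 2) by rewrite zmTE.
move: c; apply: ord4P; rewrite [mdiag _ _ _]/=.
- exact: zc.
- exact: zc.
- exact: zc.
- exact: star1.
Qed.

Lemma hdiag_star c : star (zval (h c)) = zval (h c).
Proof.
rewrite !zvalM !starM mdiag_star dl_star zmTE mT2_star (zval_comm (mdiag _ _ _)).
by rewrite (mT2_central (zval dl)).
Qed.

Lemma hmxE a b : hmx (zval dl) a b = if a == b then zval (h a) else 0.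
Proof.
rewrite mxE; case: eqP => // _; rewrite /hdiag -[dl * _ * _]mulrA zvalM; congr (_ * _).
pose u : K := 1 - zT theta ^+ 2.
move: a; apply: ord4P; rewrite [mdiag _ _ _]/=.
- rewrite -[LHS]/(Z2 * (1 - T ^+ 2) ^+ 2).
  have -> : u * (zZ2 theta * u) = zZ2 theta * u ^+ 2 by ring.
  by rewrite zvalM zvalX zmTE.
- rewrite -[LHS]/(W2 * (1 - T ^+ 2) ^+ 2).
  have -> : u * (zW2 theta * u) = zW2 theta * u ^+ 2 by ring.
  by rewrite zvalM zvalX zmTE zW2E.
- rewrite -[LHS]/(Z2 * W2 * (1 - T ^+ 2)).
  by rewrite mulrC !zvalM zmTE zW2E.
- by rewrite mulr1 zmTE.
Qed.

Lemma hformE U V : hform (zval dl) U V =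
  \sum_a star (coord U a 0) * zval (h a) * coord V a 0.
Proof.
apply: eq_bigr => a _; rewrite (bigD1 a) //= hmxE eqxx big1 ?addr0 // => b ba.
by rewrite hmxE eq_sym (negPf ba) mulr0 mul0r.
Qed.

Lemma hform_star U V : star (hform (zval dl) U V) = hform (zval dl) V U.
Proof.
rewrite !hformE star_sum; apply: eq_bigr => a _.
by rewrite starM starM starK hdiag_star mulrA.
Qed.

Lemma hform_zlin U c : hform (zval dl) U (zlin c) =
  \sum_a star (coord U a 0) * zval (h a * c a).
Proof.
rewrite hformE; apply: eq_bigr => a _; rewrite coord_lincomb mxE.
exact: esym (mulrA _ (zval (h a)) (zval (c a))).
Qed.

Lemma hform_E_zlin b c : hform (zval dl) (E theta b) (zlin c) = zval (h b * c b).
Proof.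
rewrite hform_zlin E_zlin coord_lincomb (bigD1 b) //= big1 ?addr0.
  by rewrite mxE eqxx star1 mul1r.
by move=> a ab; rewrite mxE (negPf ab) star0 mul0r.
Qed.

End Metric.

End Module.

(** * Brackets of the frame derivations *)

(** The linear algebra behind the Koszul formula: the three metric conditions and
    the three torsion conditions for the six scalar products. *)
Lemma koszul_combine (V : zmodType) (a b c d e f m1 m2 m3 t1 t2 t3 : V) :
  a + b = m1 -> c + d = m2 -> e + f = m3 ->
  a - d = t1 -> c - f = t2 -> b - e = t3 ->
  a *+ 2 = m1 + m2 - m3 + t1 - t2 - t3.
Proof.
move=> <- <- <- <- <- <-; rewrite !opprD !opprK !addrA.
rewrite [RHS](ACl (1*7*(3*9)*(2*11)*(4*8)*(5*12)*(6*10)))%AC /=.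
by rewrite !subrr !addNr !addr0 mulr2n.
Qed.

Section LeviCivita.
Variables (R : realType) (theta : R).
Local Notation A := (S4loc theta).
Local Notation T := (T theta).
Local Notation K := (Zring theta).
Local Notation coord := (@Defs.coord R theta).
Local Notation E := (E theta).
Local Notation t := (zT theta).
Local Notation z := (zZ2 theta).

Variables dt1 dt2 dt3 dt4 : A -> A.
Hypothesis Hdt : is_dtilde dt1 dt2 dt3 dt4.
Local Notation pd := (pd dt1 dt2 dt3 dt4).
Local Notation inG := (inG dt1 dt2 dt3 dt4).
Local Notation D := (zder Hdt).

(** The generators with the exponent n in the Lie algebra are vfield k u with
    u = T^n. *)
Definition vfield (k : 'I_4) (u : K) : A -> A := fun x => zval u * pd k x.

Lemma vfield1 k : vfield k 1 = pd k.
Proof. by apply/funext => x; rewrite /vfield zval1 mul1r. Qed.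

Let DD := zder_add Hdt.
Let DM := zder_mul Hdt.
Lemma zder0 i : D i 0 = 0.
Proof. by apply: zval_inj; rewrite zderE zval0 (der0 (pd_hd Hdt i)). Qed.
Lemma zder1 i : D i 1 = 0.
Proof. by apply: zval_inj; rewrite zderE zval1 (der1 (pd_hd Hdt i)). Qed.
Lemma zderN i x : D i (- x) = - D i x.
Proof. by apply: zval_inj; rewrite zderE zvalN (derN _ (pd_hd Hdt i)). Qed.

Lemma vfield_Z k u : vfield k u (Z theta) = Z theta * zval (zrateZ theta k * u).
Proof. by rewrite /vfield (pd_Z Hdt) zvalM zrateZE zval_comm mulrA. Qed.
Lemma vfield_W k u : vfield k u (W theta) = W theta * zval (zrateW theta k * u).
Proof. by rewrite /vfield (pd_W Hdt) zvalM zrateWE zval_comm mulrA. Qed.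
Lemma pd_mul_zval i a u : pd i (a * zval u) = pd i a * zval u + a * zval (D i u).
Proof. by rewrite (derM _ _ (pd_hd Hdt i)). Qed.

Lemma zT_herm : star (zval t) = zval t. Proof. exact: T_star. Qed.

Lemma brcoef_star i j : star (zval (brcoef t i j)) = zval (brcoef t i j).
Proof.
have s2 : star (zval (t *+ 2)) = zval (t *+ 2) by rewrite zvalMn !mulr2n starD zT_herm.
rewrite /brcoef; case: ifP => _; case: ifP => _; rewrite ?zval0 ?star0 //.
by rewrite zvalN -scaleN1r starZ rmorphN rmorph1 s2.
Qed.

(** Both sides are hermitian derivations, so it is enough to compare them on Z, W
    and T, where the bracket acts through derivatives of the central rates. *)
Lemma bracket_pd i j : bracket (pd i) (pd j) = vfield (brdir i j) (brcoef t i j).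
Proof.
have hdi := pd_hd Hdt i; have hdj := pd_hd Hdt j.
apply: der_ext.
- exact: hd_bracket.
- by apply: hd_central_mul; [exact: zval_comm|exact: brcoef_star|exact: pd_hd].
- rewrite vfield_Z /bracket !(pd_Z Hdt) -!zrateZE !pd_mul_zval !(pd_Z Hdt) -!zrateZE.
  rewrite -!mulrA -!zvalM -!mulrDr -mulrBr; congr (_ * _).
  rewrite -!zvalD -zvalN -zvalD; congr zval; rewrite [zrateZ _ i * _]mulrC.
  move: i j {hdi hdj}; do 2!apply: ord4P; rewrite /brdir /brcoef /zrateZ /zW2 /=
    ?(DD, DM, zderN, zder0, zder1, zder_T, zder_Z2, zder_i, expr2)
    /znormrateZ /zW2 /=; ring.
- rewrite vfield_W /bracket !(pd_W Hdt) -!zrateWE !pd_mul_zval !(pd_W Hdt) -!zrateWE.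
  rewrite -!mulrA -!zvalM -!mulrDr -mulrBr; congr (_ * _).
  rewrite -!zvalD -zvalN -zvalD; congr zval; rewrite [zrateW _ i * _]mulrC.
  move: i j {hdi hdj}; do 2!apply: ord4P; rewrite /brdir /brcoef /zrateW /zW2 /=
    ?(DD, DM, zderN, zder0, zder1, zder_T, zder_Z2, zder_i, expr2)
    /znormrateZ /zW2 /=; ring.
- have e k : pd k T = zval (D k t) by [].
  rewrite /vfield /bracket !e -!zderE -zvalM -zvalN -zvalD; congr zval.
  move: i j {hdi hdj}; do 2!apply: ord4P; rewrite /brdir /brcoef !zder_T /=
    ?(DD, DM, zderN, zder0, zder1, zder_T, expr2) /=; ring.
Qed.

End LeviCivita.

(** * Elements of the Lie algebra with coefficients in Z_loc *)

Section Connection.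
Variables (R : realType) (theta : R).
Local Notation A := (S4loc theta).
Local Notation T := (T theta).
Local Notation K := (Zring theta).
Local Notation coord := (@Defs.coord R theta).
Local Notation E := (E theta).
Local Notation t := (zT theta).
Local Notation z := (zZ2 theta).

Variables dt1 dt2 dt3 dt4 : A -> A.
Hypothesis Hdt : is_dtilde dt1 dt2 dt3 dt4.
Local Notation pd := (pd dt1 dt2 dt3 dt4).
Local Notation inG := (inG dt1 dt2 dt3 dt4).
Local Notation D := (zder Hdt).
Local Notation vf := (vfield dt1 dt2 dt3 dt4).

Variable vphi : (A -> A) -> 'cV[A]_5.
Hypothesis Hvphi : is_varphi dt1 dt2 dt3 dt4 vphi.
Variables (dl : K).
Hypothesis dl_star : star (zval dl) = zval dl.
Local Notation h := (hdiag z t dl).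
Local Notation hform := (hform (zval dl)).

Lemma vfield_add k u v : vf k (u + v) = (fun x => vf k u x + vf k v x).
Proof. by apply/funext => x; rewrite /vfield zvalD mulrDl. Qed.
Lemma vfield_opp k u : vf k (- u) = (fun x => (-1)%:C *: vf k u x).
Proof. by apply/funext => x; rewrite /vfield zvalN mulNr rmorphN rmorph1 scaleN1r. Qed.

Lemma vfield_Tn k n : k != o3 ->
  inG (vf k (t ^+ n)) /\ vphi (vf k (t ^+ n)) = vmul (E k) (T ^+ n).
Proof.
move: k; apply: ord4P => // _.
- have -> : vf o0 (t ^+ n) = d1 dt1 n.
    by apply/funext => x; rewrite /vfield pd_o0 zvalX /d1 mulrA.
  by split; [exact: inG_d1|exact: (vphi_d1 Hvphi)].
- have -> : vf o1 (t ^+ n) = d2 dt2 n.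
    by apply/funext => x; rewrite /vfield pd_o1 zvalX /d2 mulrA.
  by split; [exact: inG_d2|exact: (vphi_d2 Hvphi)].
- have -> : vf o2 (t ^+ n) = d3 dt3 n.
    by apply/funext => x; rewrite /vfield pd_o2 zvalX /d3.
  by split; [exact: inG_d3|exact: (vphi_d3 Hvphi)].
Qed.

(** A coefficient u for which vfield k u belongs to the Lie algebra and varphi has
    its expected value. Real polynomials in T qualify when k differs
    from o3, but for o3 the Lie algebra provides real constants only. *)
Definition lie_elt k u :=
  [/\ inG (vf k u), vphi (vf k u) = vmul (E k) (zval u) & star (zval u) = zval u].

Lemma lie_elt_Tn k n : k != o3 -> lie_elt k (t ^+ n).
Proof.
move=> k3; have [? ?] := vfield_Tn n k3; split=> //; first by rewrite zvalX.
by rewrite zvalX starX zT_herm.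
Qed.

Lemma lie_elt_1 k : lie_elt k 1.
Proof.
have [->|k3] := eqVneq k o3; last by have := lie_elt_Tn 0 k3; rewrite expr0.
split; last by rewrite zval1 star1.
  by rewrite vfield1; exact: inG_d4.
by rewrite vfield1 zval1 vmul1; exact: (vphi_d4 Hvphi).
Qed.

Lemma lie_elt_add k u v : lie_elt k u -> lie_elt k v -> lie_elt k (u + v).
Proof.
case=> iu pu su [iv pv sv]; split.
- by rewrite vfield_add; exact: inG_add.
- by rewrite vfield_add (vphi_add Hvphi) // pu pv -vmulDr.
- by rewrite zvalD starD su sv.
Qed.

Lemma lie_elt_opp k u : lie_elt k u -> lie_elt k (- u).
Proof.
case=> iu pu su; split.
- by rewrite vfield_opp; exact: inG_scale.
- rewrite vfield_opp (vphi_scale Hvphi) // pu vscale_vmul.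
  by rewrite rmorphN rmorph1 scaleN1r.
- by rewrite zvalN -scaleN1r starZ rmorphN rmorph1 su.
Qed.

Lemma lie_elt_0 k : lie_elt k 0.
Proof.
by rewrite -(subrr 1); apply: lie_elt_add; [|apply: lie_elt_opp]; exact: lie_elt_1.
Qed.

(** The condition under which the Koszul formula can be evaluated for vfield k u
    and two frame derivations: both terms of the bracket with a frame derivation
    have to be in the Lie algebra again. *)
Definition lie_stable k u :=
  lie_elt k u /\ forall b, lie_elt (brdir k b) (u * brcoef t k b) /\ lie_elt k (D b u).

Lemma lie_stable_1 k : lie_stable k 1.
Proof.
split=> [|b]; first exact: lie_elt_1.
split; last by rewrite zder1; exact: lie_elt_0.
rewrite mul1r /brdir /brcoef; case: ifPn => k3; case: ifPn => b3; try exact: lie_elt_0.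
- by rewrite mulr2n; apply: lie_elt_add; apply: (lie_elt_Tn 1).
- by apply: lie_elt_opp; rewrite mulr2n; apply: lie_elt_add; apply: (lie_elt_Tn 1).
Qed.

Lemma lie_stable_T k : k != o3 -> lie_stable k t.
Proof.
move=> k3; split=> [|b]; first exact: (lie_elt_Tn 1).
rewrite /brdir /brcoef (negPf k3) zder_T; split; case: ifPn => b3;
  rewrite ?mulr0; try exact: lie_elt_0.
- have -> : t * - (t *+ 2) = - (t ^+ 2 + t ^+ 2) by ring.
  by apply: lie_elt_opp; apply: lie_elt_add; exact: lie_elt_Tn.
- by apply: lie_elt_add; [exact: lie_elt_Tn|apply: lie_elt_opp; exact: lie_elt_1].
Qed.

Definition single (k : 'I_4) (u : K) (a : 'I_4) : K := if a == k then u else 0.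

Lemma vmulE_single k u : vmul (E k) (zval u) = zlin (single k u).
Proof.
rewrite E_zlin zlin_vmul; congr zlin; apply/funext => a; rewrite /single.
by case: ifP; rewrite ?mul1r ?mul0r.
Qed.

Lemma bracket_vfield k u b :
  bracket (vf k u) (pd b)
  = (fun x => vf (brdir k b) (u * brcoef t k b) x + vf k (- D b u) x).
Proof.
apply/funext => x; have /(congr1 (fun d => d x)) := bracket_pd Hdt k b.
rewrite /bracket /vfield => e.
by rewrite (derM _ _ (pd_hd Hdt b)) opprD addrA addrAC -mulrBr e mulrA zvalN mulNr.
Qed.

Lemma vphi_bracket k u b : lie_stable k u ->
  vphi (bracket (vf k u) (pd b))
  = zlin (single (brdir k b) (u * brcoef t k b)) - zlin (single k (D b u)).
Proof.
case=> _ /(_ b)[r1 r2]; rewrite bracket_vfield; have := lie_elt_opp r2.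
case: r1 => i1 e1 _ [i2 e2 _]; rewrite (vphi_add Hvphi) // e1 e2.
rewrite -!vmulE_single zvalN; congr (_ + _).
by apply/colP => i; rewrite !mxE mulrN.
Qed.

Lemma hform_subl U U' V : inM U -> inM U' -> hform (U - U') V = hform U V - hform U' V.
Proof.
case=> c -> [c' ->]; rewrite -lincombB !hformE // -sumrB; apply: eq_bigr => a _.
by rewrite !coord_lincomb !mxE starB !mulrBl.
Qed.

Lemma hform_single k u l v : star (zval u) = zval u ->
  hform (zlin (single k u)) (zlin (single l v))
  = zval (if k == l then h k * u * v else 0).
Proof.
move=> su; rewrite hform_zlin (bigD1 k) //= big1 ?addr0.
  rewrite coord_lincomb mxE /single eqxx su.
  transitivity (zval (u * (h k * (if k == l then v else 0)))); first by [].
  by congr zval; case: ifP => _; [rewrite mulrCA mulrA|rewrite !mulr0].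
by move=> a ak; rewrite coord_lincomb mxE /single (negPf ak) zval0 star0 mul0r.
Qed.

End Connection.

(** * The Levi-Civita connection and its curvature *)

(** The Koszul expression is linear over the coefficient u of its first argument:
    the derivatives of u from the metric terms and from the brackets cancel. *)
Lemma koszul_tensorial (K : comPzRingType) (D : 'I_4 -> K -> K)
    (DM : forall i x y, D i (x * y) = D i x * y + x * D i y)
    (D0 : forall i, D i 0 = 0) (h : 'I_4 -> K) (s : 'I_4 -> 'I_4 -> K) u k b c :
  u * D k (if b == c then h b * 1 * 1 else 0)
  + D b (if c == k then h c * 1 * u else 0)
  - D c (if k == b then h k * u * 1 else 0)
  + ((if brdir k b == c then h (brdir k b) * (u * s k b) * 1 else 0)
     - (if k == c then h k * D b u * 1 else 0))
  - ((if brdir b c == k then h (brdir b c) * (1 * s b c) * u else 0)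
     - (if b == k then h b * 0 * u else 0))
  - ((if brdir k c == b then h (brdir k c) * (u * s k c) * 1 else 0)
     - (if k == b then h k * D c u * 1 else 0))
  = u * ((if b == c then D k (h b) else 0) + (if c == k then D b (h k) else 0)
         - (if k == b then D c (h k) else 0)
         + h c * (if c == brdir k b then s k b else 0)
         - h k * (if k == brdir b c then s b c else 0)
         - h b * (if b == brdir k c then s k c else 0)).
Proof.
have bkE (i j l : 'I_4) (r x : K) :
    (if brdir i j == l then h (brdir i j) * r * x else 0)
   = h l * x * (if l == brdir i j then r else 0).
  by rewrite eq_sym; case: eqP => [->|_]; ring.
rewrite !bkE (eq_sym k c) (eq_sym b k) !mulr1 !mul1r.
have if_mul (bb : bool) (x y : K) :
    (if bb then x * y else 0) = x * (if bb then y else 0).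
  by case: bb; rewrite ?mulr0.
have -> : D k (if b == c then h b else 0) = if b == c then D k (h b) else 0.
  by case: ifP.
have -> : D b (if c == k then h c * u else 0)
   = (if c == k then D b (h k) else 0) * u + (if c == k then h k * D b u else 0).
  by case: eqP => [->|_]; rewrite ?DM ?D0; ring.
have -> : D c (if k == b then h k * u else 0)
   = (if k == b then D c (h k) else 0) * u + (if k == b then h k * D c u else 0).
  by case: eqP => _; rewrite ?DM ?D0; ring.
rewrite !if_mul; ring.
Qed.

Section Curvature.
Variables (R : realType) (theta : R).
Local Notation A := (S4loc theta).
Local Notation T := (T theta).
Local Notation K := (Zring theta).
Local Notation coord := (@Defs.coord R theta).
Local Notation E := (E theta).
Local Notation t := (zT theta).
Local Notation z := (zZ2 theta).

Variables dt1 dt2 dt3 dt4 : A -> A.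
Hypothesis Hdt : is_dtilde dt1 dt2 dt3 dt4.
Local Notation pd := (pd dt1 dt2 dt3 dt4).
Local Notation inG := (inG dt1 dt2 dt3 dt4).
Local Notation D := (zder Hdt).
Local Notation vf := (vfield dt1 dt2 dt3 dt4).

Variable vphi : (A -> A) -> 'cV[A]_5.
Hypothesis Hvphi : is_varphi dt1 dt2 dt3 dt4 vphi.
Variables (dl al dli : K).
Hypothesis dl_star : star (zval dl) = zval dl.
Local Notation h := (hdiag z t dl).
Local Notation hform := (hform (zval dl)).
Hypothesis Ddl : forall i, D i dl = if i == o3 then al * dl *+ 2 else 0.
Local Notation be := (D o3 al).
Hypothesis Dal : forall i, D i al = if i == o3 then be else 0.
Hypothesis dlK : dl * dli = 1.

Variable nabla : (A -> A) -> 'cV[A]_5 -> 'cV[A]_5.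
Hypothesis Hnabla : is_connection dt1 dt2 dt3 dt4 nabla.
Hypothesis nabla_metric : metric_connection dt1 dt2 dt3 dt4 (zval dl) nabla.
Hypothesis nabla_tf : torsion_free dt1 dt2 dt3 dt4 vphi nabla.
Hypothesis nabla_real : real_connection dt1 dt2 dt3 dt4 (zval dl) vphi nabla.

(** Reality turns the scalar product with the derivative in the second argument
    into one with the derivative in the first argument. *)
Lemma metric_real d e f : inG d -> inG e -> inG f -> inM (vphi e) -> inM (vphi f) ->
  hform (nabla d (vphi e)) (vphi f) + hform (nabla d (vphi f)) (vphi e)
  = d (hform (vphi e) (vphi f)).
Proof.
move=> id ie jf me mf; rewrite (nabla_metric id me mf); congr (_ + _).
by rewrite -(nabla_real id jf ie) hform_star.
Qed.

Lemma torsion_hform d e f : inG d -> inG e -> inM (vphi d) -> inM (vphi e) ->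
  hform (nabla d (vphi e)) (vphi f) - hform (nabla e (vphi d)) (vphi f)
  = hform (vphi (bracket d e)) (vphi f).
Proof.
move=> id ie md me.
rewrite -hform_subl //; [|exact: (nabla_in Hnabla)|exact: (nabla_in Hnabla)].
by congr (Defs.hform _ _ _); apply/eqP; rewrite -subr_eq0; apply/eqP/nabla_tf.
Qed.

Lemma koszul d e f : inG d -> inG e -> inG f ->
  inM (vphi d) -> inM (vphi e) -> inM (vphi f) ->
  hform (nabla d (vphi e)) (vphi f) *+ 2
  = d (hform (vphi e) (vphi f)) + e (hform (vphi f) (vphi d))
    - f (hform (vphi d) (vphi e))
    + hform (vphi (bracket d e)) (vphi f) - hform (vphi (bracket e f)) (vphi d)
    - hform (vphi (bracket d f)) (vphi e).
Proof.
move=> id ie jf md me mf.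
apply: (koszul_combine (metric_real id ie jf me mf) (metric_real ie jf id mf md)
   (metric_real jf id ie md me)); exact: torsion_hform.
Qed.

Lemma vphi_pd b : vphi (pd b) = E b.
Proof. by have [_ ] := lie_elt_1 Hvphi b; rewrite vfield1 zval1 vmul1. Qed.
Lemma inG_pd b : inG (pd b).
Proof. by have [] := lie_elt_1 Hvphi b; rewrite vfield1. Qed.
Lemma E_single b : E b = zlin (single b 1).
Proof. exact: E_zlin. Qed.

Lemma koszul_vfield k u b c : lie_stable Hdt vphi k u ->
  hform (nabla (vf k u) (E b)) (E c) = zval (h c * chris z t al k b c * u).
Proof.
move=> gu; have [[iX pX su] gb] := gu.
have mX : inM (vphi (vf k u)) by rewrite pX vmulE_single; exact: zlin_inM.
have s1 : star (zval (1 : K)) = zval 1 by rewrite zval1 star1.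
apply: S4loc_mul2I; rewrite -!vphi_pd koszul ?vphi_pd //;
  try exact: inG_pd; try exact: E_inM.
have -> : bracket (pd b) (pd c) = bracket (vf b 1) (pd c) by rewrite vfield1.
rewrite !(vphi_bracket Hvphi) //; last exact: (lie_stable_1 Hdt Hvphi).
rewrite !hform_subl; try exact: zlin_inM.
rewrite pX vmulE_single !E_single.
have su1 j : star (zval (u * brcoef t k j)) = zval (u * brcoef t k j).
  by have [[]] := gb j.
have su2 j : star (zval (D j u)) = zval (D j u) by have [_ []] := gb j.
have [sb1 sb2] : star (zval (1 * brcoef t b c)) = zval (1 * brcoef t b c) /\
    star (zval (D c 1)) = zval (D c 1).
  by have [_ /(_ c)[[_ _ ?] [_ _ ?]]] := lie_stable_1 Hdt Hvphi b.
rewrite !hform_single //.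
have vfE x : vf k u (zval x) = zval (u * D k x) by [].
rewrite vfE -!zderE -!zvalN -!zvalD -!zvalN -!zvalD -zvalMn; congr zval.
have kz := koszul_chris (zder_add Hdt) (zder_mul Hdt) (zder_Z2 Hdt) (zder_T Hdt)
  Ddl k b c.
by rewrite zder1 (koszul_tensorial (zder_mul Hdt) (zder0 Hdt)) kz; ring.
Qed.

Local Notation m := (mdiag z t).
Definition mdiag_inv (c : 'I_4) : K :=
  nth 0 [:: zZ2i theta * zmTi theta; zW2i theta * zmTi theta;
            zZ2i theta * zW2i theta; 1] c.
Definition hdiag_inv (c : 'I_4) : K := dli * zmTi theta * mdiag_inv c.

Lemma mdiagK c : m c * mdiag_inv c = 1.
Proof.
move: c; apply: ord4P; rewrite /mdiag /mdiag_inv /= -/(zW2 theta).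
- by rewrite mulrACA zZ2K zmTK mulr1.
- by rewrite mulrACA zW2K zmTK mulr1.
- by rewrite mulrACA zZ2K zW2K mulr1.
- by rewrite mulr1.
Qed.

Lemma hdiagK c : h c * hdiag_inv c = 1.
Proof.
by rewrite /hdiag /hdiag_inv mulrACA [in X in X * _]mulrACA dlK zmTK mdiagK !mulr1.
Qed.

(** The scalar products with the frame determine a vector, as the diagonal entries
    of the metric are invertible; reality is needed because the coordinates enter
    the scalar product through their adjoints. *)
Lemma christoffel k u b : lie_stable Hdt vphi k u ->
  nabla (vf k u) (E b) = zlin (fun c => chris z t al k b c * u).
Proof.
move=> gu; have [[iX _ _] _] := gu.
have [c0 c0E] := nabla_in Hnabla iX (E_inM theta b).
rewrite c0E; congr lincomb; apply/colP => c; rewrite mxE.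
have real : star (hform (nabla (vf k u) (E b)) (E c))
    = hform (nabla (vf k u) (E b)) (E c).
  by rewrite -!vphi_pd; apply: nabla_real => //; exact: inG_pd.
have := koszul_vfield b c gu; rewrite -real (hform_star dl_star) c0E => e.
have {}e : zval (h c) * c0 c 0 = zval (h c) * zval (chris z t al k b c * u).
  rewrite -zvalM mulrA -e hformE E_single /zlin !coord_lincomb.
  rewrite (bigD1 c) //= big1 ?addr0.
    by rewrite mxE /single eqxx zval1 star1 mul1r.
  by move=> a ac; rewrite mxE /single (negPf ac) star0 mul0r mul0r.
exact: zval_mulI (hdiagK c) e.
Qed.

Lemma nabla_zlin p c : nabla (pd p) (zlin c) =
  zlin (fun a => D p (c a) + \sum_e chris z t al p e a * c e).
Proof.
have ip := inG_pd p.
have nE e : nabla (pd p) (vmul (E e) (zval (c e))) =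
    zlin (fun a => chris z t al p e a * c e) + zlin (single e (D p (c e))).
  rewrite (nabla_leibniz Hnabla) //; last exact: E_inM.
  rewrite -zderE vmulE_single -vfield1 christoffel; last first.
    exact: (lie_stable_1 Hdt Hvphi).
  by rewrite zlin_vmul; congr (zlin _ + _); apply/funext => a; rewrite mulr1.
have Ein e : inM (vmul (E e) (zval (c e))) by rewrite vmulE_single; exact: zlin_inM.
have inMD (U V : 'cV[A]_5) : inM U -> inM V -> inM (U + V).
  by case=> c1 -> [c2 ->]; exists (c1 + c2); rewrite lincombD.
have in01 := inMD _ _ (Ein o0) (Ein o1); have in012 := inMD _ _ in01 (Ein o2).
rewrite {1}zlin_E sum4 !(nabla_add Hnabla) //.
rewrite !nE -!zlinD; congr zlin; apply/funext => a; rewrite sum4.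
by move: a; apply: ord4P; rewrite /single /=; ring.
Qed.

(** The bracket of two frame derivations is a real multiple of an element
    T partial_k of the Lie algebra, along which the connection is known. *)
Lemma nabla_bracket p q b :
  nabla (bracket (pd p) (pd q)) (E b) =
  zlin (fun a => brcoef t p q * chris z t al (brdir p q) b a).
Proof.
rewrite (bracket_pd Hdt).
pose nrep k u := inG (vf k u) /\
  nabla (vf k u) (E b) = zlin (fun a => u * chris z t al k b a).
suff [_ ->] : nrep (brdir p q) (brcoef t p q) by [].
have nrep_good k u : lie_stable Hdt vphi k u -> nrep k u.
  move=> gu; split; first by case: gu => -[].
  by rewrite christoffel //; congr zlin; apply/funext => a; rewrite mulrC.
have nrepD k u v : nrep k u -> nrep k v -> nrep k (u + v).
  case=> iu eu [iv ev]; split; first by rewrite vfield_add; exact: inG_add.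
  rewrite vfield_add (nabla_addl Hnabla) //; last exact: E_inM.
  by rewrite eu ev -zlinD; congr zlin; apply/funext => a; rewrite mulrDl.
have nrepN k u : nrep k u -> nrep k (- u).
  case=> iu eu; split; first by rewrite vfield_opp; exact: inG_scale.
  rewrite vfield_opp (nabla_scalel Hnabla) //; last exact: E_inM.
  have -> U : vscale (-1) U = - U :> 'cV[A]_5.
    by apply/colP => i; rewrite !mxE rmorphN rmorph1 scaleN1r.
  by rewrite eu -zlinN; congr zlin; apply/funext => a; rewrite mulNr.
have nrep0 k : nrep k 0.
  by rewrite -(subrr 1); apply: nrepD; [|apply: nrepN]; apply/nrep_good/lie_stable_1.
rewrite /brdir /brcoef; case: ifPn => p3; case: ifPn => q3; try exact: nrep0.
- by rewrite mulr2n; apply: nrepD; apply/nrep_good/lie_stable_T.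
- by apply: nrepN; rewrite mulr2n; apply: nrepD; apply/nrep_good/lie_stable_T.
Qed.

Lemma curvE p q b : curv nabla (pd p) (pd q) (E b) =
  zlin (fun a => Rmix z t al be a b p q).
Proof.
rewrite /curv nabla_bracket.
have n1 k : nabla (pd k) (E b) = zlin (fun a => chris z t al k b a).
  rewrite -vfield1 christoffel; last exact: (lie_stable_1 Hdt Hvphi).
  by congr zlin; apply/funext => a; rewrite mulr1.
rewrite !n1 !nabla_zlin -!zlinN -!zlinD; congr zlin; apply/funext => a.
exact: (curv_chris (zder_add Hdt) (zder_mul Hdt) (zder_Z2 Hdt) (zder_T Hdt)
  Dal p q b a).
Qed.

Local Notation kr := (- (be + t ^+ 2 - 1) * (dli * zmTi theta)).
Local Notation kt := ((1 - (al + t) ^+ 2) * (dli * zmTi theta)).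

Lemma RlowE a b p q : Rlow dt1 dt2 dt3 dt4 nabla (zval dl) a b p q =
  zval (Rdiag h kr kt a b p q).
Proof.
rewrite /Rlow curvE hform_E_zlin; congr zval; rewrite /Rmix /Rdiag /hdiag.
have -> : ksec kr kt p q = kcurv t al be p q * (dli * zmTi theta).
  by rewrite /ksec /kcurv; case: ifP.
have : dl * (1 - t ^+ 2) * (dli * zmTi theta) = 1.
  by rewrite mulrACA dlK zmTK mulr1.
move: (dl * _) (dli * _) (kcurv _ _ _ _ _) => s si kpq e.
case: andP => [[/eqP e1 /eqP e2]|_]; case: andP => [[/eqP e3 /eqP e4]|_];
  by subst; ring: e.
Qed.

(** A two-sided inverse is unique, also over a noncommutative ring. *)
Lemma hinvE (hinv : 'M[A]_4) : hmx (zval dl) *m hinv = 1%:M ->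
  hinv *m hmx (zval dl) = 1%:M -> forall a b, hinv a b = zval (idiag hdiag_inv a b).
Proof.
move=> e1 e2 a b.
pose hi := \matrix_(i, j) zval (idiag hdiag_inv i j) : 'M[A]_4.
suff -> : hinv = hi by rewrite mxE.
have e3 : hmx (zval dl) *m hi = 1%:M.
  apply/matrixP => i j; rewrite !mxE (bigD1 i) //= big1 ?addr0.
    rewrite hmxE eqxx mxE -zvalM /idiag; case: eqP => [->|_]; rewrite ?mulr0 //.
    by rewrite hdiagK.
  by move=> k ki; rewrite hmxE eq_sym (negPf ki) mul0r.
by rewrite -[hinv]mulmx1 -e3 mulmxA e2 mul1mx.
Qed.

Lemma gauss_bonnetE (hinv : 'M[A]_4) : hmx (zval dl) *m hinv = 1%:M ->
  hinv *m hmx (zval dl) = 1%:M ->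
  gauss_bonnet dt1 dt2 dt3 dt4 nabla (zval dl) hinv = zval (kr * kt *+ 24).
Proof.
move=> e1 e2; have hE := hinvE e1 e2.
have RupE a b c d : Rup dt1 dt2 dt3 dt4 nabla (zval dl) hinv a b c d =
    zval (\sum_p \sum_q \sum_r \sum_s idiag hdiag_inv a p * idiag hdiag_inv b q *
      idiag hdiag_inv c r * idiag hdiag_inv d s * Rdiag h kr kt p q r s).
  by do 4![rewrite zval_sum; apply: eq_bigr => ? _]; rewrite RlowE !hE.
have RicE a b : Riclow dt1 dt2 dt3 dt4 nabla (zval dl) hinv a b =
    zval (\sum_p \sum_q idiag hdiag_inv p q * Rdiag h kr kt a p b q).
  by do 2![rewrite zval_sum; apply: eq_bigr => ? _]; rewrite RlowE hE.
have RicupE a b : Ricup dt1 dt2 dt3 dt4 nabla (zval dl) hinv a b =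
    zval (\sum_p \sum_q idiag hdiag_inv a p * idiag hdiag_inv b q *
      (\sum_r \sum_s idiag hdiag_inv r s * Rdiag h kr kt p r q s)).
  by do 2![rewrite zval_sum; apply: eq_bigr => ? _]; rewrite RicE !hE.
rewrite -(gb_sum kr kt hdiagK) zvalD zvalD zvalN zvalMn zvalX /gauss_bonnet.
congr (_ - _ *+ 4 + _ ^+ 2).
- by do 4![rewrite zval_sum; apply: eq_bigr => ? _]; rewrite RupE RlowE.
- by do 2![rewrite zval_sum; apply: eq_bigr => ? _]; rewrite RicE RicupE.
- by do 2![rewrite zval_sum; apply: eq_bigr => ? _]; rewrite RicE hE.
Qed.

End Curvature.

(** * Polynomials in T and the values of phi_0 *)

Section PolyT.
Variables (R : realType) (theta : R).
Local Notation A := (S4loc theta).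
Local Notation K := (Zring theta).
Local Notation t := (zT theta).

Definition zconst (k : R[i]) : K := zring (Zl_scale k (Zl_one theta)).

Lemma zconstE k : zval (zconst k) = k *: (1 : A). Proof. by []. Qed.
Lemma zconstD a b : zconst (a + b) = zconst a + zconst b.
Proof. by apply: zval_inj; rewrite zvalD !zconstE scalerDl. Qed.
Lemma zconst0 : zconst 0 = 0.
Proof. by apply: zval_inj; rewrite zconstE scale0r. Qed.
Lemma zconstMn a n : zconst (a *+ n) = zconst a *+ n.
Proof.
by elim: n => [|n IH]; rewrite ?mulr0n ?zconst0 // !mulrS zconstD IH.
Qed.

Definition zpoly (p : {poly R}) : K := \sum_(k < size p) zconst (p`_k)%:C * t ^+ k.

Lemma zpolyE p : zval (zpoly p) = polyT theta p.
Proof.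
rewrite zval_sum; apply: eq_bigr => k _.
by rewrite zvalM zvalX zconstE scal_mulAl mul1r.
Qed.

(** Summing up to a common bound lets the sums for p and for its derivative be
    compared term by term. *)
Lemma zpoly_wide n (p : {poly R}) : (size p <= n)%N ->
  zpoly p = \sum_(k < n) zconst (p`_k)%:C * t ^+ k.
Proof.
move=> pn; rewrite /zpoly (big_ord_widen n (fun k => zconst (p`_k)%:C * t ^+ k)) //.
rewrite big_mkcond; apply: eq_bigr => k _; case: ltnP => // pk.
by rewrite nth_default // rmorph0 zconst0 mul0r.
Qed.

Lemma zpoly_star p : star (zval (zpoly p)) = zval (zpoly p).
Proof.
rewrite zpolyE star_sum; apply: eq_bigr => k _.
rewrite starZ starX T_star; congr (_ *: _); exact: conjc_real.
Qed.

Variables dt1 dt2 dt3 dt4 : A -> A.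
Hypothesis Hdt : is_dtilde dt1 dt2 dt3 dt4.
Local Notation D := (zder Hdt).

Lemma zder_const i k : D i (zconst k) = 0.
Proof.
have hd := pd_hd Hdt i; apply: zval_inj; rewrite zderE zconstE (derZ _ _ hd).
by rewrite (der1 hd) scaler0.
Qed.

Lemma zder_sum i (I : Type) (r : seq I) (P : pred I) (F : I -> K) :
  D i (\sum_(j <- r | P j) F j) = \sum_(j <- r | P j) D i (F j).
Proof. exact: (big_morph _ (zder_add Hdt i) (zder0 Hdt i)). Qed.

Lemma zder_exp i x n : D i (x ^+ n) = x ^+ n.-1 * D i x *+ n.
Proof.
elim: n => [|[|n] IH]; first by rewrite expr0 zder1 mulr0n.
  by rewrite expr1 mul1r mulr1n.
by rewrite exprS zder_mul IH /= !exprS; ring.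
Qed.

(** The chain rule; only the fourth derivation moves T. *)
Lemma zder_poly i p :
  D i (zpoly p) = if i == o3 then zpoly p^`() * (t ^+ 2 - 1) else 0.
Proof.
have -> : D i (zpoly p) = zpoly p^`() * D i t.
  rewrite (@zpoly_wide (size p).+1) //.
  rewrite (@zpoly_wide (size p) p^`()); last first.
    by rewrite (leq_trans (size_poly _ _)) // leq_pred.
  rewrite zder_sum big_ord_recl zder_mul zder_const expr0 zder1 mul0r mulr0 !add0r.
  rewrite mulr_suml.
  apply: eq_bigr => k _; rewrite zder_mul zder_const mul0r add0r zder_exp /=.
  rewrite /bump /= add1n.
  by rewrite coef_deriv rmorphMn /= zconstMn; ring.
by rewrite zder_T; case: ifP; rewrite ?mulr0.
Qed.

End PolyT.

Section Evaluation.
Variables (R : realType) (theta : R).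
Local Notation A := (S4loc theta).
Local Notation K := (Zring theta).
Local Notation t := (zT theta).
Variable phi0 : A -> R -> R -> R -> R -> R[i].
Hypothesis Hphi0 : is_phi0 phi0.
Variables x1 x2 ph ps : R.
Hypothesis box : in_box x1 x2 ph ps.

Definition ev (x : K) : R[i] := phi0 (zval x) x1 x2 ph ps.

Lemma evD x y : ev (x + y) = ev x + ev y.
Proof. exact: (phi0_add Hphi0 (zvalP x) (zvalP y) box). Qed.
Lemma evM x y : ev (x * y) = ev x * ev y.
Proof. exact: (phi0_mul Hphi0 (zvalP x) (zvalP y) box). Qed.
Lemma ev1 : ev 1 = 1.
Proof. exact: (phi0_one Hphi0 box). Qed.
Lemma evN x : ev (- x) = - ev x.
Proof.
rewrite /ev zvalN -scaleN1r (phi0_scale Hphi0 _ (zvalP x) box).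
by rewrite mulN1r.
Qed.
Lemma ev0 : ev 0 = 0.
Proof. by rewrite -(subrr 1) evD evN subrr. Qed.
Lemma evMn x n : ev (x *+ n) = ev x *+ n.
Proof. by elim: n => [|n IH]; rewrite ?mulr0n ?ev0 // !mulrS evD IH. Qed.
Lemma evX x n : ev (x ^+ n) = ev x ^+ n.
Proof. by elim: n => [|n IH]; rewrite ?expr0 ?ev1 // !exprS evM IH. Qed.
Lemma ev_const k : ev (zconst theta k) = k.
Proof.
rewrite /ev zconstE (phi0_scale Hphi0 _ (Zl_one theta) box).
by rewrite (phi0_one Hphi0 box) mulr1.
Qed.
Lemma ev_T : ev t = (sin ps)%:C.
Proof. exact: (phi0_T Hphi0 box). Qed.
Lemma ev_poly p : ev (zpoly theta p) = (p.[sin ps])%:C.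
Proof.
rewrite horner_coef rmorph_sum /= (big_morph ev evD ev0); apply: eq_bigr => k _.
by rewrite evM ev_const evX ev_T rmorphM rmorphXn.
Qed.

End Evaluation.

(** * The integral along a meridian *)

Section Profile.
Local Open Scope classical_set_scope.
Variables (R : realType) (n q : {poly R}).
Hypothesis q_neq0 : forall x, -1 <= x <= 1 -> q.[x] != 0.

(** The function F of the height; it is applied with the value of alpha as n / q,
    so that F is the value of alpha + T. *)
Definition profile (x : R) : R := x + n.[x] / q.[x].
Definition dprofile (x : R) : R :=
  1 + (n^`().[x] * q.[x] - n.[x] * q^`().[x]) / q.[x] ^+ 2.
(** One twenty-fourth of the factor of the Gauss-Bonnet density that depends on
    psi. *)
Definition gb_density (s : R) : R :=
  (1 - profile (sin s) ^+ 2) * dprofile (sin s) * cos s.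
Definition gb_primitive (s : R) : R := profile (sin s) - profile (sin s) ^+ 3 / 3.

Lemma q_sin_neq0 s : q.[sin s] != 0.
Proof. by apply: q_neq0; rewrite sin_geN1 sin_le1. Qed.

Lemma is_derive_profile (x : R) :
  q.[x] != 0 -> is_derive x (1 : R) profile (dprofile x).
Proof.
move=> q0.
have dV : is_derive x (1 : R) (fun y => (q.[y])^-1) (- q.[x] ^- 2 *: q^`().[x]).
  exact: is_deriveV.
apply: trigger_derive; rewrite /dprofile /GRing.scale /=; field.
exact: q0.
Qed.

Lemma is_derive_gb_primitive (s : R) : is_derive s (1 : R) gb_primitive (gb_density s).
Proof.
have d1 : is_derive s (1 : R) (profile \o sin) (cos s * dprofile (sin s)).
  have dp := is_derive_profile (q_sin_neq0 s).
  by apply: trigger_derive; rewrite /GRing.scale /= mulrC.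
have -> : gb_primitive = (profile \o sin) - (3^-1) *: ((profile \o sin) ^+ 3).
  by apply/funext => y; rewrite /gb_primitive !fctE /= mulrC.
apply: trigger_derive; rewrite /gb_density /GRing.scale /=; field.
by [].
Qed.

Lemma continuous_gb_density : continuous gb_density.
Proof.
have ch (r : {poly R}) : continuous (fun s => r.[sin s]).
  by move=> s; apply: continuous_comp; [exact: continuous_sin|exact: continuous_horner].
have cV : continuous (fun s => (q.[sin s])^-1).
  by move=> s; apply: cvgV; [exact: q_sin_neq0|exact: ch].
have cp : continuous (fun s => profile (sin s)).
  move=> s; apply: cvgD; first exact: continuous_sin.
  by apply: cvgM; [exact: ch|exact: cV].
have cd : continuous (fun s => dprofile (sin s)).
  move=> s; apply: cvgD; first exact: cvg_cst.
  apply: cvgM; first by apply: cvgB; apply: cvgM; exact: ch.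
  under eq_fun do rewrite -exprVn expr2.
  by rewrite -exprVn expr2; apply: cvgM; exact: cV.
move=> s; apply: cvgM; last exact: continuous_cos.
apply: cvgM; last exact: cd.
apply: cvgB; first exact: cvg_cst.
under eq_fun do rewrite expr2.
by rewrite expr2; apply: cvgM; exact: cp.
Qed.

End Profile.

Section Integrals.
Local Open Scope classical_set_scope.
Variable R : realType.
Notation mu := (@lebesgue_measure R).
Implicit Types (f F : R -> R) (a b : R).

Lemma continuous_integrable_oo f a b : continuous f ->
  mu.-integrable `]a, b[ (EFin \o f).
Proof.
move=> cf; apply: (@integrableS _ _ _ mu `[a, b]) => //.
  exact: subset_itv_oo_cc.
apply: continuous_compact_integrable; first exact: segment_compact.
exact: continuous_subspaceT.
Qed.

(** For a function that is continuous on the line, the open interval may be closed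
    without changing the integral. *)
Lemma Rintegral_oo_FTC f F a b : a < b -> continuous f ->
  (forall x, is_derive x (1 : R) F (f x)) ->
  \int[mu]_(x in `]a, b[) f x = F b - F a.
Proof.
move=> ab cf dF.
have cF : continuous F.
  move=> x; apply/differentiable_continuous/derivable1_diffP.
  by have [] := dF x.
rewrite Rintegral_itv_bndo_bndc; last exact: continuous_integrable_oo.
rewrite Rintegral_itv_obnd_cbnd; last first.
  apply: (@integrableS _ _ _ mu `[a, b]) => //; first exact: subset_itv_oc_cc.
  apply: continuous_compact_integrable; first exact: segment_compact.
  exact: continuous_subspaceT.
rewrite /Rintegral (@continuous_FTC2 _ _ F) //.
- exact: continuous_subspaceT.
- split.
  + by move=> x _; have [] := dF x.
  + by apply: cvg_at_right_filter; exact: cF.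
  + by apply: cvg_at_left_filter; exact: cF.
- by move=> x _; rewrite derive1E; have [_ ->] := dF x.
Qed.

Lemma Rintegral_sin_cos : \int[mu]_(x in `]0, pi / 2[) (sin x * cos x) = 2^-1 :> R.
Proof.
have dF (x : R) : is_derive x (1 : R) (fun y => sin y ^+ 2 / 2) (sin x * cos x).
  have -> : (fun y : R => sin y ^+ 2 / 2) = (2^-1 : R) *: (sin ^+ 2 : R -> R).
    by apply/funext => y; rewrite !fctE /= mulrC.
  by apply: trigger_derive; rewrite /GRing.scale /=; field.
rewrite (Rintegral_oo_FTC _ _ dF).
- by rewrite sin_pihalf sin0 expr1n expr0n /= mul0r subr0 mul1r.
- by rewrite divr_gt0 // pi_gt0.
- by move=> x; apply: cvgM; [exact: continuous_sin|exact: continuous_cos].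
Qed.

Lemma Rintegral_oo_cst (c a b : R) : a < b ->
  \int[mu]_(x in `]a, b[) c = c * (b - a).
Proof.
move=> ab; rewrite Rintegral_cst //= lebesgue_measure_itv /= lte_fin ab.
by rewrite -EFinB.
Qed.

(** The primitive is F - F^3 / 3, and F takes the values 1 and -1 at the ends
    because n vanishes there. *)
Lemma Rintegral_gb_density (n q : {poly R}) :
  (forall x, -1 <= x <= 1 -> q.[x] != 0) -> n.[1] = 0 -> n.[-1] = 0 ->
  \int[mu]_(x in `]- (pi / 2), pi / 2[) gb_density n q x = 4 / 3.
Proof.
move=> q0 n1 nN1; have dF := is_derive_gb_primitive n q0.
rewrite (Rintegral_oo_FTC _ _ dF).
- by rewrite /gb_primitive /profile sinN sin_pihalf n1 nN1 !mul0r !addr0; field.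
- have := pi_gt0 R; lra.
- exact: continuous_gb_density.
Qed.

End Integrals.

(** * Functions of separated variables on the parameter box *)

Section Box.
Local Open Scope classical_set_scope.
Variable R : realType.
Notation mu := (@lebesgue_measure R).

Lemma bounded_continuous_oo (f : R -> R) (a b : R) : continuous f ->
  exists M : R, forall x, a < x < b -> `|f x| <= M.
Proof.
move=> cf.
have := compact_bounded (continuous_compact
  (continuous_subspaceT cf (A := `[a, b])) (@segment_compact R a b)).
case=> M [_ /(_ (M + 1))] HM; exists (M + 1) => x /andP[ax xb].
apply: HM; first by rewrite ltrDl.
by exists x => //=; rewrite in_itv /= !ltW.
Qed.

(** A bounded measurable function on a set of finite measure. *)
Lemma box_integrable (g k : R -> R) (a b c d a' b' c' d' : R) :
  continuous g -> continuous k ->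
  (mu \x mu \x mu \x mu)%E.-integrable
     (`]a, b[ `*` `]c, d[ `*` `]a', b'[ `*` `]c', d'[)
     (fun x : R * R * R * R => (g x.1.2 * k x.2)%:E).
Proof.
move=> cg ck.
have mI (x y : R) : measurable `]x, y[ by exact: measurable_itv.
have fI (x y : R) : (mu `]x, y[ < +oo)%E.
  by rewrite lebesgue_measure_itv /=; case: ifP => _; rewrite ?ltry // -EFinB ltry.
have m2 : measurable (`]a, b[ `*` `]c, d[) by exact: measurableX.
have m3 : measurable (`]a, b[ `*` `]c, d[ `*` `]a', b'[) by exact: measurableX.
have fX (dT : measure_display) (T : measurableType dT)
    (nu : {measure set T -> \bar R}) (A : set T) (x y : R) :
    measurable A -> (nu A < +oo)%E -> ((nu \x mu) (A `*` `]x, y[) < +oo)%E.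
  move=> mA nuA; rewrite product_measure1E //.
  by rewrite lte_mul_pinfty // ?ge0_fin_numE // fI.
apply: measurable_bounded_integrable.
- exact: measurableX.
- by do 2!apply: (fX) => //; apply: (fX); [exact: mI|exact: fI].
- apply: measurable_funTS; apply: measurable_funM.
  + apply: measurableT_comp; first exact: continuous_measurable_fun.
    exact: measurableT_comp.
  + by apply: measurableT_comp; first exact: continuous_measurable_fun.
- have [M HM] := bounded_continuous_oo a' b' cg.
  have [N HN] := bounded_continuous_oo c' d' ck.
  exists (M * N); split; first exact: num_real.
  move=> L ML x [[_ /= x3] /= x4].
  apply: le_trans (ltW ML); rewrite normrM ler_pM //; [exact: HM|exact: HN].
Qed.

End Box.

Section Poles.
Local Open Scope classical_set_scope.

(** Let p = r (X - e)^k with r(e) nonzero. Then (x^2 - 1) p'(x) / (2 p(x)) equals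
    (x + e) (k r(x) + (x - e) r'(x)) / (2 r(x)) away from e, which tends to e k. A
    vanishing limit thus forces k = 0. *)
Lemma pole_nonroot (R : realType) (p : {poly R}) (e : R) (F : set_system R)
    (FF : ProperFilter F) (s a : R -> R) :
  e * e = 1 -> p != 0 -> s x @[x --> F] --> e ->
  (\forall x \near F, p.[s x] != 0 /\
     a x = (('X^2 - 1) * p^`()).[s x] / (p *+ 2).[s x]) ->
  a x @[x --> F] --> (0 : R) -> p.[e] != 0.
Proof.
move=> ee p0 se near_a a0; apply/negP => pe.
have [k [r + pE]] := multiplicity_XsubC p e; rewrite p0 /= => re.
have k0 : (k != 0)%N.
  by apply: contraNneq re => k0; rewrite /root -[r]mulr1 -(expr0 ('X - e%:P)) -k0 -pE.
case: k k0 pE => // k _ pE.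
pose b (x : R) := (x + e) * (k.+1%:R * r.[x] + (x - e) * (r^`()).[x]) / (r.[x] *+ 2).
have ab : \forall x \near F, b (s x) = a x.
  near=> x.
  have [px ->] : p.[s x] != 0 /\ a x = (('X^2 - 1) * p^`()).[s x] / (p *+ 2).[s x].
    by near: x.
  move: px; rewrite /b pE derivM deriv_exp derivXsubC !hornerE /= => px.
  move: (s x) px => y; rewrite mulf_eq0 expf_eq0 /= negb_or => /andP[ry ye].
  rewrite hornerMn exprS; set c := (y - e) ^+ k.
  have c0 : c != 0 by rewrite expf_neq0.
  have y2 : y ^+ 2 - 1 = (y - e) * (y + e) by rewrite -ee; ring.
  rewrite ?y2 ?hornerE exprS -/c; move: c c0 => c c0; field.
  by rewrite -mulr2n mulrn_eq0 /= !mulf_eq0 !negb_or ry ye c0.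
have be : b (s x) @[x --> F] --> b e.
  apply: (cvg_comp s b se).
  have ch (u : {poly R}) : {for e, continuous (fun x => u.[x])}.
    exact: continuous_horner.
  apply: cvgM.
    apply: cvgM; first by apply: cvgD; [exact: cvg_id|exact: cvg_cst].
    apply: cvgD; first by apply: cvgM; [exact: cvg_cst|exact: ch].
    by apply: cvgM; [apply: cvgB; [exact: cvg_id|exact: cvg_cst]|exact: ch].
  apply: cvgV; first by rewrite mulrn_eq0 /= -/(root r e).
  by rewrite mulr2n; under eq_fun do rewrite mulr2n; apply: cvgD; exact: ch.
have : b e = 0.
  apply: (@cvg_unique _ (@norm_hausdorff _ R) (a @ F)) => //.
  apply: cvg_trans be; apply: near_eq_cvg; exact: ab.
rewrite /b subrr mul0r addr0 => /eqP; apply/negP.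
have e0 : e != 0.
  by apply/eqP => e0; move: ee; rewrite e0 mulr0 => /esym/eqP; rewrite oner_eq0.
by rewrite -mulr2n !mulf_neq0 ?invr_eq0 ?mulrn_eq0 //= ?pnatr_eq0.
Unshelve. all: by end_near. Qed.

End Poles.

Section CInt.
Local Open Scope classical_set_scope.
Variable R : realType.
Notation mu := (@lebesgue_measure R).

Lemma cint_real (D : set R) (f : R -> R[i]) (g : R -> R) :
  (forall x, D x -> f x = (g x)%:C) ->
  cint D f = (\int[mu]_(x in D) g x)%:C.
Proof.
move=> fg; rewrite /cint; congr (_ +i* _).
  by apply: eq_Rintegral => x /set_mem Dx; rewrite fg.
rewrite (@eq_Rintegral _ _ _ mu D (cst 0)); last first.
  by move=> x /set_mem Dx; rewrite fg.
by rewrite /Rintegral /= integral0.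
Qed.

End CInt.

(** From alpha delta = (T^2 - 1) p' / 2 and its derivative along the fourth
    derivation one solves for alpha and for the derivative of alpha + T. *)
Lemma profile_field (K : numFieldType) (s P p1 p2 A B : K) : P != 0 ->
  A * P *+ 2 = p1 * (s ^+ 2 - 1) ->
  (B * P + A * (p1 * (s ^+ 2 - 1))) *+ 2
    = p2 * (s ^+ 2 - 1) * (s ^+ 2 - 1) + p1 * (s * (s ^+ 2 - 1) *+ 2) ->
  A = (s ^+ 2 - 1) * p1 / (P *+ 2) /\
  B + s ^+ 2 - 1 = (s ^+ 2 - 1) * (1 + ((s *+ 2 * p1 + (s ^+ 2 - 1) * p2) * (P *+ 2)
     - (s ^+ 2 - 1) * p1 * (p1 *+ 2)) / (P *+ 2) ^+ 2).
Proof.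
move=> P0 hA hB.
have hA' : A = (s ^+ 2 - 1) * p1 / (P *+ 2).
  rewrite (mulrC _ p1) -hA; field.
  by rewrite P0.
split=> //; rewrite hA' in hB.
have -> : B = ((p2 * (s ^+ 2 - 1) * (s ^+ 2 - 1) + p1 * (s * (s ^+ 2 - 1) *+ 2)) / 2
    - (s ^+ 2 - 1) * p1 / (P *+ 2) * (p1 * (s ^+ 2 - 1))) / P.
  rewrite -hB; field.
  by rewrite P0.
field.
by rewrite P0.
Qed.

Section SeparatedBox.
Local Open Scope classical_set_scope.
Variable R : realType.
Notation mu := (@lebesgue_measure R).
Notation I1 := (`]0, 2 * pi[ : set R).
Notation I3 := (`]- (pi / 2), pi / 2[ : set R).
Notation I4 := (`]0, pi / 2[ : set R).
Variables (f : R -> R -> R -> R -> R[i]) (g k : R -> R).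
Hypotheses (cg : continuous g) (ck : continuous k).
Hypothesis fE : forall x1 x2 ph ps, in_box x1 x2 ph ps ->
  f x1 x2 ps ph = (g ps * k ph)%:C.

Let boxP x1 x2 ps ph : I1 x1 -> I1 x2 -> I3 ps -> I4 ph -> in_box x1 x2 ph ps.
Proof. by rewrite /= !in_itv. Qed.

Lemma separated_integrable :
  (mu \x mu \x mu \x mu)%E.-integrable (I1 `*` I1 `*` I3 `*` I4)
     (fun x => (complex.Re (f x.1.1.1 x.1.1.2 x.1.2 x.2))%:E) /\
  (mu \x mu \x mu \x mu)%E.-integrable (I1 `*` I1 `*` I3 `*` I4)
     (fun x => (complex.Im (f x.1.1.1 x.1.1.2 x.1.2 x.2))%:E).
Proof.
have mbox : measurable (I1 `*` I1 `*` I3 `*` I4).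
  by do 3![apply: measurableX => //].
have c0 : continuous (cst (0 : R) : R -> R) by move=> ?; exact: cvg_cst.
split.
- apply: eq_integrable (box_integrable 0 (2 * pi) 0 (2 * pi) (- (pi / 2)) (pi / 2)
    0 (pi / 2) cg ck) => //.
  by move=> [[[a1 a2] a3] a4] /set_mem [[[b1 b2] b3] b4]; rewrite fE //; exact: boxP.
- apply: eq_integrable (box_integrable 0 (2 * pi) 0 (2 * pi) (- (pi / 2)) (pi / 2)
    0 (pi / 2) c0 ck) => //.
  move=> [[[a1 a2] a3] a4] /set_mem [[[b1 b2] b3] b4]; rewrite fE /=; last exact: boxP.
  by rewrite mul0r.
Qed.

Lemma separated_cint :
  cint I1 (fun x1 => cint I1 (fun x2 => cint I3 (fun ps => cint I4 (f x1 x2 ps))))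
  = ((2 * pi) ^+ 2 * (\int[mu]_(s in I3) g s) * (\int[mu]_(s in I4) k s))%:C.
Proof.
have pi0 := pi_gt0 R.
set G := \int[mu]_(s in I3) g s; set H := \int[mu]_(s in I4) k s.
have e4 x1 x2 ps : I1 x1 -> I1 x2 -> I3 ps -> cint I4 (f x1 x2 ps) = (H * g ps)%:C.
  move=> h1 h2 h3; rewrite (@cint_real _ _ _ (fun ph => g ps * k ph)).
    by rewrite RintegralZl //; [rewrite mulrC|exact: continuous_integrable_oo].
  by move=> ph h4; rewrite fE //; exact: boxP.
have e3 x1 x2 : I1 x1 -> I1 x2 -> cint I3 (fun ps => cint I4 (f x1 x2 ps)) = (H * G)%:C.
  move=> h1 h2; rewrite (@cint_real _ _ _ (fun ps => H * g ps)).
    by rewrite RintegralZl //; exact: continuous_integrable_oo.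
  by move=> ps h3; rewrite e4.
have e2 x1 : I1 x1 ->
    cint I1 (fun x2 => cint I3 (fun ps => cint I4 (f x1 x2 ps)))
    = (H * G * (2 * pi))%:C.
  move=> h1; rewrite (@cint_real _ _ _ (fun=> H * G)).
    by rewrite Rintegral_oo_cst ?subr0 // mulr_gt0.
  by move=> x2 h2; rewrite e3.
rewrite (@cint_real _ _ _ (fun=> H * G * (2 * pi))); last by move=> x1 h1; rewrite e2.
rewrite Rintegral_oo_cst ?subr0 ?mulr_gt0 //; congr (_%:C); ring.
Qed.

End SeparatedBox.

(** * The Gauss-Bonnet density in coordinates *)

Section Density.
Variables (R : realType) (theta : R).
Local Notation A := (S4loc theta).
Local Notation K := (Zring theta).
Local Notation t := (zT theta).
Variables dt1 dt2 dt3 dt4 : A -> A.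
Hypothesis Hdt : is_dtilde dt1 dt2 dt3 dt4.
Local Notation D := (zder Hdt).
Variables (p : {poly R}) (al dli : K).
Local Notation dl := (zpoly theta p).
Hypothesis dlK : dl * dli = 1.
Hypothesis alE : D o3 dl = al * dl *+ 2.
Local Notation be := (D o3 al).

(** The relation of alpha and delta makes alpha the quotient of these two. *)
Definition alpha_num : {poly R} := ('X^2 - 1) * p^`().
Definition alpha_den : {poly R} := p *+ 2.

Lemma zder_delta i : D i dl = if i == o3 then al * dl *+ 2 else 0.
Proof. by case: eqP => [->|/eqP ni] //; rewrite zder_poly (negPf ni). Qed.

(** As alpha is a function of T, the first three derivations kill it: apply them
    to the relation that defines alpha and cancel delta. *)
Lemma zder_alpha i : D i al = if i == o3 then be else 0.
Proof.
case: eqP => [->|/eqP ni] //.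
have := congr1 (D i) alE; rewrite zder_poly eqxx !mulr2n !(zder_add, zder_mul).
rewrite zder_delta (negPf ni) zderN zder1 expr2 ?zder_mul zder_T zder_poly (negPf ni).
rewrite !(mulr0, mul0r, addr0, oppr0) => /esym e.
have {}e : (D i al * dl) *+ 2 = 0 *+ 2 by rewrite mulr2n e mul0rn.
by move/Zring_mul2I/(congr1 ( *%R^~ dli)): e; rewrite -mulrA dlK mulr1 mul0r.
Qed.

Variable phi0 : A -> R -> R -> R -> R -> R[i].
Hypothesis Hphi0 : is_phi0 phi0.

Section Point.
Variables x1 x2 ph ps : R.
Hypothesis box : in_box x1 x2 ph ps.
Local Notation ev := (ev phi0 x1 x2 ph ps).

Lemma p_sin_neq0 : p.[sin ps] != 0.
Proof.
have := congr1 ev dlK; rewrite (evM Hphi0 box) (ev1 Hphi0 box) (ev_poly Hphi0 box).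
by apply: contra_eq_neq => ->; rewrite rmorph0 mul0r eq_sym oner_neq0.
Qed.

Lemma ev_alpha :
  ev al = (alpha_num.[sin ps] / alpha_den.[sin ps])%:C /\
  ev be + (sin ps)%:C ^+ 2 - 1
    = ((sin ps ^+ 2 - 1) * dprofile alpha_num alpha_den (sin ps))%:C.
Proof.
have P0 := p_sin_neq0.
have h1 := congr1 ev alE.
have h2 := congr1 (fun x => ev (D o3 x)) alE; move: h1 h2.
rewrite zder_poly eqxx !mulr2n !(zder_add, zder_mul) !zderN !zder1 expr2 ?zder_mul.
rewrite alE !zder_poly !zder_T !eqxx.
rewrite !mulr2n !(evD Hphi0 box, evM Hphi0 box, evN Hphi0 box, ev1 Hphi0 box,
  ev0 Hphi0 box, ev_poly Hphi0 box, ev_T Hphi0 box, evX Hphi0 box).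
set S := (sin ps)%:C; set P := (p.[sin ps])%:C; set p1 := (p^`().[sin ps])%:C.
set p2 := (_.[sin ps])%:C; set a := ev al; set b := ev be => h1 h2.
have PC0 : P != 0 by rewrite fmorph_eq0.
have e1 : a * P *+ 2 = p1 * (S ^+ 2 - 1) by rewrite mulr2n -h1 expr2.
have h3 : (b * P + a * (p1 * (S ^+ 2 - 1))) *+ 2
    = p2 * (S ^+ 2 - 1) * (S ^+ 2 - 1) + p1 * (S * (S ^+ 2 - 1) *+ 2).
  transitivity (p2 * (S ^+ 2 - 1) * (S ^+ 2 - 1)
      + p1 * ((S ^+ 2 - 1) * S + S * (S ^+ 2 - 1) - 0)); last by ring.
  by rewrite h2 -e1; ring.
have [-> ->] := profile_field PC0 e1 h3.
rewrite /dprofile /alpha_num /alpha_den derivM derivMn derivB derivXn derivC subr0.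
rewrite !hornerE /= ?expr1; split;
  rewrite !(rmorphM, rmorphB, rmorphD, rmorphMn, rmorphXn, fmorphV, rmorph1);
  by rewrite ?expr2 ?mulr2n.
Qed.

Let kr := - (be + t ^+ 2 - 1) * (dli * zmTi theta).
Let kt := (1 - (al + t) ^+ 2) * (dli * zmTi theta).

(** The conformal factor cancels, and 1 - T^2 becomes the square of cos psi: two of
    these squares stand in the denominator, one comes from the derivative of
    alpha + T, and the volume element has the third power of cos psi. *)
Lemma tau_integrandE :
  tau_integrand phi0 (zval dl) (zval (kr * kt *+ 24)) x1 x2 ps ph
  = ((gb_density alpha_num alpha_den ps *+ 24) * (sin ph * cos ph))%:C.
Proof.
have [ea eb] := ev_alpha.
have cos0 : 0 < cos ps.
  by apply: cos_gt0_pihalf; case: box.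
have e1 := congr1 ev dlK; have e2 := congr1 ev (zmTK theta).
move: e1 e2 ; rewrite !(evD Hphi0 box, evM Hphi0 box, evN Hphi0 box, ev1 Hphi0 box,
  ev_poly Hphi0 box, ev_T Hphi0 box, evX Hphi0 box) => e1 e2.
have P0 := p_sin_neq0; have c0 : cos ps != 0 by rewrite gt_eqF.
have ed : ev dli = (p.[sin ps]^-1)%:C.
  apply: (@mulfI _ (p.[sin ps])%:C); first by rewrite fmorph_eq0.
  by rewrite e1 -rmorphM divff.
have c2 : 1 - sin ps ^+ 2 = cos ps ^+ 2 by rewrite -(cos2Dsin2 ps) addrK.
have em : ev (zmTi theta) = (cos ps ^- 2)%:C.
  apply: (@mulfI _ (cos ps ^+ 2)%:C); first by rewrite fmorph_eq0 expf_neq0.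
  rewrite -{1}c2 rmorphB rmorph1 rmorphXn e2 -rmorphM divff ?expf_neq0 //.
have -> : tau_integrand phi0 (zval dl) (zval (kr * kt *+ 24)) x1 x2 ps ph
   = ev (kr * kt *+ 24) * ev (dl ^+ 2) * (cos ps ^+ 3 * sin ph * cos ph)%:C.
  by rewrite /tau_integrand -zvalX.
rewrite /kr /kt (evMn Hphi0 box) !(evD Hphi0 box, evM Hphi0 box, evN Hphi0 box,
  ev1 Hphi0 box, ev_poly Hphi0 box, ev_T Hphi0 box, evX Hphi0 box) eb ea ed em.
rewrite /gb_density /profile; set f := _ / _; set d := dprofile _ _ _.
have -> : (1 - (sin ps + f) ^+ 2) * d * cos ps *+ 24 * (sin ph * cos ph)
  = - ((sin ps ^+ 2 - 1) * d) * (p.[sin ps]^-1 * cos ps ^- 2)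
    * ((1 - (f + sin ps) ^+ 2) * (p.[sin ps]^-1 * cos ps ^- 2)) *+ 24
    * p.[sin ps] ^+ 2 * (cos ps ^+ 3 * sin ph * cos ph).
  rewrite -[sin ps ^+ 2 - 1]opprB c2; field.
  by rewrite P0 c0.
move: ((sin ps ^+ 2 - 1) * d) (p.[sin ps]^-1) (cos ps ^- 2) => a b c.
move: (cos ps ^+ 3 * sin ph * cos ph) => k; move: f p.[sin ps] (sin ps) => f' P s.
rewrite rmorphM rmorphM rmorphMn !rmorphM rmorphN.
by rewrite rmorphB ?rmorphM rmorphD rmorph1.
Qed.

End Point.

End Density.

Section AlphaPoles.
Local Open Scope classical_set_scope.

(** Between the poles p cannot vanish because delta is invertible there; at the
    poles pole_nonroot applies. *)
Lemma pole_nonroots (R : realType) (theta : R) dt1 dt2 dt3 dt4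
    (Hdt : @is_dtilde R theta dt1 dt2 dt3 dt4) (p : {poly R}) (al dli : Zring theta)
    phi0 (Hphi0 : is_phi0 phi0) :
  zpoly theta p * dli = 1 -> zder Hdt o3 (zpoly theta p) = al * zpoly theta p *+ 2 ->
  vanishes_at_poles (phi0 (zval al)) ->
  forall x, -1 <= x <= 1 -> (alpha_den p).[x] != 0.
Proof.
move=> dlK alE /(_ pi pi (pi / 4)) van x.
have pi0 := pi_gt0 R.
have boxP ps : - (pi / 2) < ps < pi / 2 -> in_box (pi : R) pi (pi / 4) ps.
  by move=> h; split=> //; apply/andP; split; lra.
have [|||al1 _ alN1 _] := van; try by apply/andP; split; lra.
have p0 : p != 0.
  have /boxP b0 : - (pi / 2) < (0 : R) < pi / 2 by apply/andP; split; lra.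
  by apply: contraTneq (p_sin_neq0 dlK Hphi0 b0) => ->; rewrite horner0 eqxx.
have nr : p.[1] != 0.
  apply: (@pole_nonroot _ p 1 _ _ (@sin R) _ _ p0 _ _ al1); first by rewrite mulr1.
    rewrite -[X in _ --> X]sin_pihalf.
    by apply: cvg_at_left_filter; exact: continuous_sin.
  near=> ps.
  have /boxP b : - (pi / 2) < ps < pi / 2.
    by apply/andP; split; near: ps; [apply: nbhs_left_gt; lra|exact: nbhs_left_lt].
  split; first exact: (p_sin_neq0 dlK Hphi0 b).
  by have [e _] := ev_alpha dlK alE Hphi0 b; rewrite /ev in e; rewrite e.
have nrN : p.[-1] != 0.
  apply: (@pole_nonroot _ p (-1) _ _ (@sin R) _ _ p0 _ _ alN1).
    by rewrite mulrNN mulr1.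
    rewrite -[X in _ --> - X]sin_pihalf -sinN.
    by apply: cvg_at_right_filter; exact: continuous_sin.
  near=> ps.
  have /boxP b : - (pi / 2) < ps < pi / 2.
    by apply/andP; split; near: ps; [exact: nbhs_right_gt|apply: nbhs_right_lt; lra].
  split; first exact: (p_sin_neq0 dlK Hphi0 b).
  by have [e _] := ev_alpha dlK alE Hphi0 b; rewrite /ev in e; rewrite e.
rewrite /alpha_den hornerMn mulrn_eq0 /= le_eqVlt => /andP[/predU1P[<- //|x1]].
rewrite le_eqVlt => /predU1P[-> //|x2].
have /boxP b : - (pi / 2) < asin x < pi / 2.
  by rewrite asin_gtNpi2 ?asin_ltpi2 // ?x1 ?x2 ?ltW.
have xI : -1 <= x <= 1 by rewrite !ltW.
have [_ sx] := asin_def xI.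
by have := p_sin_neq0 dlK Hphi0 b; rewrite sx.
Unshelve. all: by end_near. Qed.

End AlphaPoles.

Theorem theorem4p3 (R : realType) (theta : R) (theta01 : 0 <= theta < 1)
    (dt1 dt2 dt3 dt4 : S4loc theta -> S4loc theta)
    (Hdt : is_dtilde dt1 dt2 dt3 dt4)
    (p : {poly R}) (delta : S4loc theta) (deltaE : delta = polyT theta p)
    (delta_inv : exists2 e, Zloc e & delta * e = 1)
    (alpha : S4loc theta) (alpha_Zloc : Zloc alpha)
    (alphaE : dt4 delta = (alpha * delta) *+ 2)
    (hinv : 'M[S4loc theta]_4)
    (hmxV : hmx delta *m hinv = 1%:M) (hVmx : hinv *m hmx delta = 1%:M)
    (vphi : (S4loc theta -> S4loc theta) -> 'cV[S4loc theta]_5)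
    (Hvphi : is_varphi dt1 dt2 dt3 dt4 vphi)
    (nabla : (S4loc theta -> S4loc theta) ->
             'cV[S4loc theta]_5 -> 'cV[S4loc theta]_5)
    (Hnabla : is_connection dt1 dt2 dt3 dt4 nabla)
    (nabla_metric : metric_connection dt1 dt2 dt3 dt4 delta nabla)
    (nabla_tf : torsion_free dt1 dt2 dt3 dt4 vphi nabla)
    (nabla_real : real_connection dt1 dt2 dt3 dt4 delta vphi nabla)
    (phi0 : S4loc theta -> R -> R -> R -> R -> R[i]) (Hphi0 : is_phi0 phi0)
    (alpha_poles : vanishes_at_poles (phi0 alpha)) :
  let GB := gauss_bonnet dt1 dt2 dt3 dt4 nabla delta hinv in
  tau_defined phi0 delta GB /\
  ((32 * pi ^+ 2)^-1)%:C * tau phi0 delta GB = 2.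
Proof.
move=> GB; have [e Ze de] := delta_inv.
pose dl := zpoly theta p; pose dli := zring Ze; pose al := zring alpha_Zloc.
have dE : delta = zval dl by rewrite zpolyE.
have dlK : dl * dli = 1 by apply: zval_inj; rewrite zvalM -dE.
have alE : zder Hdt o3 dl = al * dl *+ 2.
  by apply: zval_inj; rewrite zderE zvalMn zvalM -dE.
have Ddl := zder_delta alE; have Dal := zder_alpha dlK alE.
rewrite dE in nabla_metric nabla_real hmxV hVmx.
have GBE := gauss_bonnetE Hvphi (zpoly_star theta p) Ddl Dal dlK Hnabla
  nabla_metric nabla_tf nabla_real hmxV hVmx.
have q0 := pole_nonroots Hphi0 dlK alE alpha_poles.
have n1 : (alpha_num p).[1] = 0 by rewrite /alpha_num !hornerE /= expr1n subrr mul0r.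
have nN1 : (alpha_num p).[-1] = 0.
  by rewrite /alpha_num !hornerE /= sqrrN expr1n subrr mul0r.
have cont_dens := continuous_gb_density (n := alpha_num p) q0.
have tiE x1 x2 ph ps : in_box x1 x2 ph ps -> tau_integrand phi0 delta GB x1 x2 ps ph =
    ((gb_density (alpha_num p) (alpha_den p) ps *+ 24) * (sin ph * cos ph))%:C.
  by move=> b; rewrite -(tau_integrandE dlK alE Hphi0 b) /GB dE GBE.
have cont_g : continuous (fun ps => gb_density (alpha_num p) (alpha_den p) ps *+ 24).
  move=> s; under eq_fun do rewrite -mulr_natr; rewrite -mulr_natr.
  by apply: cvgM; [exact: cont_dens|exact: cvg_cst].
have cont_k : continuous (fun ph : R => sin ph * cos ph).
  by move=> s; apply: cvgM; [exact: continuous_sin|exact: continuous_cos].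
have pi0 := pi_gt0 R.
have [iRe iIm] := separated_integrable cont_g cont_k tiE.
split; first by split=> //; rewrite /GB dE GBE; exact: zvalP.
rewrite /tau (separated_cint cont_g cont_k tiE) Rintegral_sin_cos.
have -> : (\int[lebesgue_measure]_(s in `]- (pi / 2), pi / 2[%classic)
    (gb_density (alpha_num p) (alpha_den p) s *+ 24)) = 32 :> R.
  under eq_Rintegral do rewrite -mulr_natl.
  rewrite RintegralZl //; last exact: continuous_integrable_oo.
  by rewrite Rintegral_gb_density //; field.
rewrite -rmorphM -[RHS](rmorph_nat (real_complex R)); congr (_%:C).
have : pi != 0 :> R by rewrite gt_eqF.
by move: (pi : R) => P P0; field.
Qed.
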